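(* Let $(\Lambda,\le)$ be a directed poset, let $(X,\mu)$ be a measure space of the type described in the context, and let $\{\mathcal{H}_p;\ \mathcal{E}_p=\{\mathcal{H}_{\alpha,p}\}_{\alpha\in\Lambda};\ \mathcal{D}_p\}_{p\in X}$ be a family of quantized domains. Suppose that either $\Lambda$ is a countable set or $\mu$ is a counting measure on $X$. Then $$C^*_{\mathcal{E},\mathrm{DEC}}\left(\int^{\oplus_{\mathrm{loc}}}_{X_{\mathrm{loc}}}\mathcal{D}_p\,d\mu(p)\right)=\left(C^*_{\mathcal{E},\mathrm{DIAG}}\left(\int^{\oplus_{\mathrm{loc}}}_{X_{\mathrm{loc}}}\mathcal{D}_p\,d\mu(p)\right)\right)',$$ where the commutant $'$ is taken in $C^*_{\mathcal{E}}\left(\int^{\oplus_{\mathrm{loc}}}_{X_{\mathrm{loc}}}\mathcal{D}_p\,d\mu(p)\right)$.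
   Context: **Measure space.** $X$ is a $\sigma$-compact locally compact space and $\mu$ is the completion of a positive Borel measure on $X$. **Strictly inductive system, locally Hilbert space, quantized domain.** Let $(\Lambda,\le)$ be a directed poset. A family $\mathcal{F}=\{\mathcal{H}_\alpha\}_{\alpha\in\Lambda}$ of Hilbert spaces is a strictly inductive system if, whenever $\alpha\le\beta$, $\mathcal{H}_\alpha\subseteq\mathcal{H}_\beta$ and the inclusion is isometric. Its inductive limit is $\mathcal{D}=\bigcup_{\alpha\in\Lambda}\mathcal{H}_\alpha$, called a locally Hilbert space. A quantized domain $\{\mathcal{H};\mathcal{F}=\{\mathcal{H}_\alpha\}_{\alpha\in\Lambda};\mathcal{D}\}$ consists of a strictly inductive system $\mathcal{F}$, the locally Hilbert space $\mathcal{D}=\bigcup_\alpha\mathcal{H}_\alpha$, and the Hilbert space $\mathcal{H}=\overline{\mathcal{D}}$ which is the completion of $\mathcal{D}$. **Locally bounded operators and commutant.** $C^*_{\mathcal{F}}(\mathcal{D})$ is the set of linear operators $T:\mathcal{D}\to\mathcal{D}$ such that for each $\alpha\in\Lambda$: $T(\mathcal{H}_\alpha)\subseteq\mathcal{H}_\alpha$, $T(\mathcal{H}_\alpha^\perp\cap\mathcal{D})\subseteq\mathcal{H}_\alpha^\perp\cap\mathcal{D}$, and $T|_{\mathcal{H}_\alpha}\in\mathcal{B}(\mathcal{H}_\alpha)$. For $\mathcal{M}\subseteq C^*_{\mathcal{F}}(\mathcal{D})$, the commutant is $\mathcal{M}'=\{T\in C^*_{\mathcal{F}}(\mathcal{D}):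 TS=ST\text{ for all }S\in\mathcal{M}\}$. **Direct integral of Hilbert spaces.** Let $\{\mathcal{K}_p\}_{p\in X}$ be a family of separable Hilbert spaces. A separable Hilbert space $\mathcal{K}$ is the direct integral of $\{\mathcal{K}_p\}$ over $(X,\mu)$, written $\mathcal{K}=\int_X^\oplus\mathcal{K}_p\,d\mu(p)$, when to each $x\in\mathcal{K}$ there corresponds a function $p\mapsto x(p)$ on $X$ with $x(p)\in\mathcal{K}_p$ for each $p$, such that: (1) $p\mapsto\langle x(p),y(p)\rangle$ is $\mu$-integrable for all $x,y\in\mathcal{K}$ and $\langle x,y\rangle=\int_X\langle x(p),y(p)\rangle\,d\mu(p)$; (2) if $x_p\in\mathcal{K}_p$ for all $p\in X$ and $p\mapsto\langle x_p,y(p)\rangle$ is integrable for each $y\in\mathcal{K}$, then there is $x\in\mathcal{K}$ with $x(p)=x_p$ for $\mu$-a.e. $p$. **Standing setting.** All $\mathcal{H}_p$ (hence all $\mathcal{H}_{\alpha,p}$) are separable, and the direct integrals $\int_X^\oplus\mathcal{H}_{\alpha,p}\,d\mu(p)$ ($\alpha\in\Lambda$) and $\int_X^\oplus\mathcal{H}_p\,d\mu(p)$ are given. For $\alpha\le\beta$ one has $\int_X^\oplus\mathcal{H}_{\alpha,p}\,d\mu(p)\subseteq\int_X^\oplus\mathcal{H}_{\beta,p}\,d\mu(p)\subseteq\int_X^\oplus\mathcal{H}_p\,d\mu(p)$, coming from $\mathcal{H}_{\alpha,p}\subseteq\mathcal{H}_{\beta,p}\subseteq\mathcal{H}_p$ (an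 element keeps the same function $p\mapsto x(p)$, up to a.e. equality). Put $\mathcal{E}=\{\int_X^\oplus\mathcal{H}_{\alpha,p}\,d\mu(p)\}_{\alpha\in\Lambda}$, a strictly inductive system, and $$\int^{\oplus_{\mathrm{loc}}}_{X_{\mathrm{loc}}}\mathcal{D}_p\,d\mu(p):=\bigcup_{\alpha\in\Lambda}\int_X^\oplus\mathcal{H}_{\alpha,p}\,d\mu(p),$$ the direct integral of the locally Hilbert spaces $\mathcal{D}_p$. **Decomposable and diagonalizable locally bounded operators.** $T\in C^*_{\mathcal{E}}\left(\int^{\oplus_{\mathrm{loc}}}_{X_{\mathrm{loc}}}\mathcal{D}_p\,d\mu(p)\right)$ is decomposable if there is a family $\{T_p\in C^*_{\mathcal{E}_p}(\mathcal{D}_p)\}_{p\in X}$ such that for every $u\in\int^{\oplus_{\mathrm{loc}}}_{X_{\mathrm{loc}}}\mathcal{D}_p\,d\mu(p)$, $(Tu)(p)=T_pu(p)$ for a.e. $p\in X$. $T$ is diagonalizable if it is decomposable and there is a measurable function $f:X\to\mathbb{C}$ such that for every such $u$, $(Tu)(p)=f(p)u(p)$ for a.e. $p\in X$. The sets of all decomposable and all diagonalizable operators are denoted $C^*_{\mathcal{E},\mathrm{DEC}}\left(\int^{\oplus_{\mathrm{loc}}}_{X_{\mathrm{loc}}}\mathcal{D}_p\,d\mu(p)\right)$ and $C^*_{\mathcal{E},\mathrm{DIAG}}\left(\int^{\oplus_{\mathrm{loc}}}_{X_{\mathrm{loc}}}\mathcal{D}_p\,d\mu(p)\right)$ respectively.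 *)

(* Defs.v *)
From HB Require Import structures.
From mathcomp Require Import all_boot all_order all_algebra.
From mathcomp Require Import sesquilinear.
From mathcomp Require Import all_classical all_reals all_analysis.
From mathcomp Require Import complex.
Set Implicit Arguments.
Unset Strict Implicit.
Unset Printing Implicit Defensive.
Import Order.TTheory GRing.Theory Num.Theory.
Import numFieldNormedType.Exports.
Local Open Scope classical_set_scope.
Local Open Scope ring_scope.
Local Open Scope complex_scope.

(* The inner product is linear in its first argument and conjugate-linear in
   the second one; norms take their values in R[i]. *)
HB.mixin Record CompleteNormedModule_isHilbert (R : realType) V
    of CompleteNormedModule R[i] V := {
  inner : {dot V for (@Num.conj R[i])} ;
  inner_norm : forall x : V, `|x| ^+ 2 = inner x x
}.

#[short(type="hilbertType")]
HB.structure Definition Hilbert (R : realType) :=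
  {V of CompleteNormedModule R[i] V & CompleteNormedModule_isHilbert R V}.

(* No relation between the two structures is built in; the sigma-algebra is
   tied to the topology by [borel_completion]. *)
#[short(type="measurableTopologicalType")]
HB.structure Definition MeasurableTopological d :=
  {X of Measurable d X & Topological X}.

Section measure_space.
Context d (X : measurableTopologicalType d) (R : realType).
Variable mu : {measure set X -> \bar R}.

Definition sigma_compact :=
  exists2 K : nat -> set X, (forall n, compact (K n)) & \bigcup_n K n = setT.

(* mu is the completion of its restriction to the Borel sets. *)
Definition borel_completion := forall A : set X, measurable A <->
  exists B C, [/\ (<<s @open X >>) B, (<<s @open X >>) C, B `<=` A, A `<=` C &
    mu (C `\` B) = 0%E].

Definition is_counting_measure :=
  forall A : set X, measurable A -> mu A = counting A.

Definition cmeasurable (f : X -> R[i]) :=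
  measurable_fun setT (fun p => complex.Re (f p)) /\
  measurable_fun setT (fun p => complex.Im (f p)).

Definition cintegrable (f : X -> R[i]) :=
  mu.-integrable setT (fun p => (complex.Re (f p))%:E) /\
  mu.-integrable setT (fun p => (complex.Im (f p))%:E).

Definition cintegral (f : X -> R[i]) : R[i] :=
  (\int[mu]_p complex.Re (f p)) +i* (\int[mu]_p complex.Im (f p)).

End measure_space.

Section hilbert_subspaces.
Context (R : realType) (H : hilbertType R).
Implicit Types V : set H.

(* In a Hilbert space, the subsets that are Hilbert spaces for the inherited
   operations and inner product are the closed linear subspaces. *)
Definition hilbert_subspace V :=
  [/\ V 0, forall (a : R[i]) x y, V x -> V y -> V (a *: x + y) & closed V].

Definition separable_set V :=
  exists A : set H, [/\ countable A, A `<=` V & V `<=` closure A].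

Definition orthogonal_set V : set H :=
  [set x | forall y, V y -> inner x y = 0].

End hilbert_subspaces.

Record directedPoset (dL : Order.disp_t) := DirectedPoset {
  directed_sort :> porderType dL ;
  directed_inhabited : inhabited directed_sort ;
  directed_le : forall a b : directed_sort,
    exists c : directed_sort, (a <= c)%O /\ (b <= c)%O
}.

(* The members of the system are realized inside one Hilbert space H, so that
   the inclusions between them are automatically isometric. *)
Record inductiveSystem (R : realType) dL (L : directedPoset dL)
    (H : hilbertType R) := InductiveSystem {
  system_set :> L -> set H ;
  system_hilbert : forall a, hilbert_subspace (system_set a) ;
  system_le : forall a b, (a <= b)%O -> system_set a `<=` system_set b
}.

Section locally_hilbert.
Context (R : realType) dL (L : directedPoset dL) (H : hilbertType R).
Variable F : inductiveSystem L H.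

Definition limit_pred : {pred H} :=
  fun x => `[< (\bigcup_(a in [set: L]) F a) x >].

Lemma limit_submod_closed : submod_closed limit_pred.
Proof.
split.
  have [a] := directed_inhabited L.
  by apply/asboolP; exists a => //; have [] := system_hilbert F a.
move=> k x y /asboolP[a _ Fx] /asboolP[b _ Fy].
have [c [ac bc]] := directed_le a b.
apply/asboolP; exists c => //.
have [_ + _] := system_hilbert F c.
by apply; [exact: (system_le ac)|exact: (system_le bc)].
Qed.

HB.instance Definition _ :=
  GRing.isSubmodClosed.Build R[i] H limit_pred limit_submod_closed.

Record locHilbert := LocHilbert {
  locHilbert_val : H ;
  locHilbert_valP : locHilbert_val \in limit_pred
}.

HB.instance Definition _ := [isSub for locHilbert_val].
HB.instance Definition _ := [Choice of locHilbert by <:].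
HB.instance Definition _ := [SubChoice_isSubLmodule of locHilbert by <:].

Definition locBounded : set {linear locHilbert -> locHilbert} :=
  [set T | forall a : L,
    [/\ forall u : locHilbert, F a (\val u) -> F a (\val (T u)),
        forall u : locHilbert, orthogonal_set (F a) (\val u) ->
          orthogonal_set (F a) (\val (T u)) &
        exists M : R, forall u : locHilbert, F a (\val u) ->
          `|\val (T u)| <= M%:C * `|\val u| ]].

Definition commutant (S : set {linear locHilbert -> locHilbert}) :=
  [set T | locBounded T /\ forall U, S U -> T \o U =1 U \o T].

End locally_hilbert.

Record quantizedDomain (R : realType) dL (L : directedPoset dL) :=
    QuantizedDomain {
  qspace : hilbertType R ;
  qsystem : inductiveSystem L qspace ;
  qsystem_dense : dense (\bigcup_(a in [set: L]) qsystem a)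
}.

Section direct_integral.
Context d (X : measurableTopologicalType d) (R : realType).
Variable mu : {measure set X -> \bar R}.

(* The fibres are the Hilbert subspaces V p of H p and the total space is the
   Hilbert subspace W of K; the element x of W corresponds to the function
   p |-> ev x p, and the values of ev outside W are irrelevant. *)
Definition direct_integral (H : X -> hilbertType R) (V : forall p, set (H p))
    (K : hilbertType R) (W : set K) (ev : K -> forall p, H p) :=
  [/\ hilbert_subspace W /\ separable_set W,
      forall x, W x -> forall p, V p (ev x p),
      forall x y, W x -> W y ->
        cintegrable mu (fun p => inner (ev x p) (ev y p)) /\
        inner x y = cintegral mu (fun p => inner (ev x p) (ev y p)) &
      forall w : forall p, H p, (forall p, V p (w p)) ->
        (forall y, W y -> cintegrable mu (fun p => inner (w p) (ev y p))) ->
        exists2 x, W x & {ae mu, forall p, ev x p = w p}].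

Section decomposable.
Context dL (L : directedPoset dL) (Q : X -> quantizedDomain R L).
Context (K : hilbertType R) (E : inductiveSystem L K).
Variable ev : K -> forall p, qspace (Q p).

(* When E consists of the direct integrals of the members of the systems
   qsystem (Q p), the value ev (\val u) p belongs to the locally Hilbert space
   of Q p for almost every p; it is replaced by 0 at the other points. *)
Definition value_at (u : locHilbert E) p : locHilbert (qsystem (Q p)) :=
  insubd 0 (ev (\val u) p).

Definition locDecomposable : set {linear locHilbert E -> locHilbert E} :=
  [set T | locBounded T /\
    exists2 T_ : forall p, {linear locHilbert (qsystem (Q p)) ->
                                   locHilbert (qsystem (Q p))},
      forall p, locBounded (T_ p) &
      forall u, {ae mu, forall p, value_at (T u) p = T_ p (value_at u p)}].

Definition locDiagonalizable : set {linear locHilbert E -> locHilbert E} :=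
  [set T | locDecomposable T /\
    exists2 f : X -> R[i], cmeasurable f &
      forall u, {ae mu, forall p, value_at (T u) p = f p *: value_at u p}].

End decomposable.
End direct_integral.

Arguments locDecomposable {d X R} mu {dL L Q K} E ev _.
Arguments locDiagonalizable {d X R} mu {dL L Q K} E ev _.

(* Main.v *)
Require Import Defs.
From HB Require Import structures.
From mathcomp Require Import all_boot all_order all_algebra.
From mathcomp Require Import sesquilinear.
From mathcomp Require Import all_classical all_reals all_analysis.
From mathcomp Require Import measurable_realfun complex.
From mathcomp Require Import ring lra.
Set Implicit Arguments.
Unset Strict Implicit.
Unset Printing Implicit Defensive.
Import Order.TTheory GRing.Theory Num.Theory.
Import numFieldNormedType.Exports.
Local Open Scope classical_set_scope.
Local Open Scope ring_scope.
Local Open Scope complex_scope.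

(* An operator commuting with the diagonalizable operators commutes with the
   multiplications by indicator functions; localizing the bound of T on E a to
   arbitrary measurable sets gives |(T u)(p)| <= M |u(p)| for almost every p.
   Along a dense sequence of E a this holds simultaneously off one null set, for
   all combinations with rational complex coefficients.  The values of the
   sequence are dense in almost every fibre, by the selection property of direct
   integrals, so (s n)(p) |-> (T (s n))(p) extends to a bounded operator on that
   fibre.  For varying indices, the fibre operators are compatible and preserve
   orthogonal complements off null sets; these add up to a null set, either
   because the index set is countable or because a set that is null for the
   counting measure is empty.

   Conversely, a decomposable operator commutes pointwise with scalars, and an
   element of the total space is determined by its values almost everywhere. *)

Local Notation Re := complex.Re.
Local Notation Im := complex.Im.

(** * Geometry of Hilbert spaces *)

Section real_norm.
Context (R : realType) (H : hilbertType R).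
Implicit Types (x y z : H) (a : R[i]).

(* The norm of H takes its values in R[i]; nr is the same norm with values in R. *)
Definition nr x : R := Re `|x|.

Lemma nrE x : `|x| = (nr x)%:C.
Proof. by rewrite /nr RRe_real // normr_real. Qed.

Lemma nr_ge0 x : 0 <= nr x.
Proof. by rewrite -ler0c -nrE. Qed.

Lemma nr0 : nr (0 : H) = 0.
Proof. by rewrite /nr normr0. Qed.

Lemma nr_eq0 x : nr x = 0 -> x = 0.
Proof. by move=> x0; apply/normr0_eq0; rewrite nrE x0. Qed.

Lemma nrD x y : nr (x + y) <= nr x + nr y.
Proof. by rewrite -lecR rmorphD /= -!nrE ler_normD. Qed.

Lemma nrZ a x : nr (a *: x) = Re `|a| * nr x.
Proof.
have ea : `|a| = (Re `|a|)%:C by rewrite RRe_real ?normr_real.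
by have := normrZ a x; rewrite !nrE {1}ea -rmorphM => /complexI.
Qed.

Lemma nrN x : nr (- x) = nr x.
Proof. by rewrite /nr normrN. Qed.

Lemma nrB x y : nr (x - y) = nr (y - x).
Proof. by rewrite -nrN opprB. Qed.

Lemma nr_tri z x y : nr (x - y) <= nr (x - z) + nr (z - y).
Proof. by have := nrD (x - z) (z - y); rewrite addrA subrK. Qed.

Lemma innerC x y : inner x y = (inner y x)^*.
Proof. by rewrite (hermC (@inner R H)) expr0 mul1r. Qed.

Lemma innerDl x y z : inner (x + y) z = inner x z + inner y z.
Proof. exact: linearDl. Qed.

Lemma innerBl x y z : inner (x - y) z = inner x z - inner y z.
Proof. exact: linearBl. Qed.

Lemma innerZl a x z : inner (a *: x) z = a * inner x z.
Proof. exact: linearZl_LR. Qed.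

Lemma innerBr x y z : inner z (x - y) = inner z x - inner z y.
Proof. exact: linearBr. Qed.

Lemma innerZr a x z : inner z (a *: x) = a^* * inner z x.
Proof. exact: linearZr_LR. Qed.

Lemma inner0r x : inner x 0 = 0. Proof. exact: linear0r. Qed.

Lemma inner0l x : inner 0 x = 0. Proof. exact: linear0l. Qed.

Lemma inner_nr x : inner x x = (nr x ^+ 2)%:C.
Proof. by rewrite -inner_norm nrE rmorphXn. Qed.

Lemma nr_sq x : nr x ^+ 2 = Re (inner x x).
Proof. by rewrite inner_nr. Qed.

Lemma nr_sqB x y : nr (x - y) ^+ 2 = nr x ^+ 2 + nr y ^+ 2 - 2 * Re (inner x y).
Proof.
rewrite !nr_sq innerBl !innerBr (innerC y x).
case: (inner x x) (inner x y) (inner y y) => [a b] [c e] [f g] /=; ring.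
Qed.

(** The squared norm of [|y|^2 x - <x,y> y] expands to [|y|^2 (|x|^2 |y|^2 - |<x,y>|^2)]; positivity
    of this product gives the inequality when [y] is nonzero. *)
Lemma cauchy_schwarz x y :
  Re (inner x y) ^+ 2 + Im (inner x y) ^+ 2 <= nr x ^+ 2 * nr y ^+ 2.
Proof.
have [y0|y0] := eqVneq (nr y) 0.
  by rewrite (nr_eq0 y0) inner0r /= nr0 !expr0n /= mulr0 addr0.
have Np : 0 < nr y ^+ 2 by rewrite exprn_gt0// lt_neqAle eq_sym y0 nr_ge0.
have := sqr_ge0 (nr ((nr y ^+ 2)%:C *: x - inner x y *: y)).
rewrite nr_sqB !nr_sq !innerZl !innerZr !inner_nr.
move: (nr x ^+ 2) (nr y ^+ 2) (inner x y) Np => r s [p q] s0 /=.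
set t := (X in 0 <= X).
have -> : t = s * (r * s - (p ^+ 2 + q ^+ 2)) by rewrite /t; ring.
by rewrite pmulr_rge0// subr_ge0.
Qed.

Lemma inner_eq0_lim x y :
  (forall e : R, 0 < e :> R -> exists2 z, inner x z = 0 & nr (y - z) < e) -> inner x y = 0.
Proof.
move=> xy0.
have le0 : Re (inner x y) ^+ 2 + Im (inner x y) ^+ 2 <= 0.
  apply/ler_addgt0Pl => e e0; rewrite addr0.
  set n2 := nr x ^+ 2; have n0 : 0 <= n2 by rewrite sqr_ge0.
  (* Cauchy-Schwarz bounds the error by [n2 * nr (y - z) ^+ 2]; this tolerance keeps it within [e],
     and the [+ 1] covers [n2 = 0]. *)
  have d0 : 0 < Num.sqrt (e / (n2 + 1)).
    by rewrite sqrtr_gt0 divr_gt0// ltr_wpDl.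
  have [z xz yz] := xy0 _ d0.
  have -> : inner x y = inner x (y - z) by rewrite innerBr xz subr0.
  apply: (le_trans (cauchy_schwarz _ _)).
  have : nr (y - z) ^+ 2 <= e / (n2 + 1).
    rewrite -[leRHS]sqr_sqrtr; last exact: divr_ge0 (ltW e0) (addr_ge0 n0 ler01).
    by apply: lerXn2r; rewrite ?nnegrE ?nr_ge0 ?sqrtr_ge0// ltW.
  move=> /(ler_wpM2l n0)/le_trans; apply.
  rewrite mulrCA; apply: ler_piMr; first exact: ltW.
  by rewrite ler_pdivrMr ?ltr_wpDl// mul1r lerDl.
move: (inner x y) le0 => [p q] /= le0.
have p0 : p ^+ 2 = 0 by have := sqr_ge0 p; have := sqr_ge0 q; lra.
have q0 : q ^+ 2 = 0 by have := sqr_ge0 q; lra.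
by move/eqP: p0; move/eqP: q0; rewrite !sqrf_eq0 => /eqP-> /eqP->.
Qed.

Lemma nr_eq_lim x y : (forall e : R, 0 < e :> R -> nr (x - y) <= e) -> x = y.
Proof.
move=> xy; apply/subr0_eq/nr_eq0/eqP; rewrite eq_le nr_ge0 andbT.
by apply/ler_addgt0Pl => e e0; rewrite addr0 xy.
Qed.

Lemma closed_nr (V : set H) y : closed V ->
  (forall e : R, 0 < e :> R -> exists2 z, V z & nr (y - z) < e) -> V y.
Proof.
move=> cV h; apply: cV => B /nbhs_ballP[e /= e0 yB].
(* A positive element of [R[i]] has zero imaginary part, so its real part is the same radius. *)
have e0' : 0 < Re e by move: e0; rewrite ltcE => /andP[_].
have [z Vz yz] := h _ e0'.
exists z; split => //; apply: yB; rewrite -ball_normE /= nrE.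
move: e0; rewrite !ltcE /= => /andP[/eqP -> _]; by rewrite eqxx.
Qed.

Lemma closure_nr (V : set H) y : closure V y ->
  forall e : R, 0 < e :> R -> exists2 z, V z & nr (y - z) < e.
Proof.
move=> cV e e0.
have /cV[z [Vz]] : nbhs y (ball y e%:C) by apply: nbhsx_ballx; rewrite ltcR.
by rewrite -ball_normE /= nrE ltcR => yz; exists z.
Qed.

Lemma nr_complete (u : nat -> H) :
  (forall e : R, 0 < e :> R -> exists N, forall m n, (N <= m)%N -> (N <= n)%N ->
     nr (u m - u n) < e) ->
  exists l, forall e : R, 0 < e :> R -> exists N, forall n, (N <= n)%N -> nr (l - u n) < e.
Proof.
move=> cu.
have uc : cvg (u @ \oo).
  apply/cauchy_cvgP/cauchy_ballP => e e0.
  have e0' : 0 < Re e by move: e0; rewrite ltcE => /andP[_].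
  have ee : e = (Re e)%:C by rewrite RRe_real// gtr0_real.
  have [N uN] := cu _ e0'.
  exists ([set u n | n in [set n | (N <= n)%N]], [set u n | n in [set n | (N <= n)%N]]).
    by split; exists N => // n Nn; exists n.
  move=> [_ _] [[m Nm <-] [n Nn <-]]; rewrite /= -ball_normE /= nrE ee ltcR.
  exact: uN.
exists (lim (u @ \oo)) => e e0.
have e0' : 0 < e%:C :> R[i] by rewrite ltcR.
have /cvgrPdist_lt/(_ _ e0')[N _ uN] := uc.
by exists N => n Nn; have := uN n Nn; rewrite /= nrE ltcR.
Qed.

End real_norm.

Lemma le_addr_epsilon (R : realType) (C a b : R) : 0 <= C :> R ->
  (forall e : R, 0 < e :> R -> a <= b + C * e) -> a <= b.
Proof.
move=> C0 ab; apply/ler_addgt0Pr => e e0.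
have C1 : 0 < C + 1 by lra.
apply: (le_trans (ab (e / (C + 1)) _)); first by rewrite divr_gt0.
rewrite lerD2l mulrCA; apply: ler_piMr; first exact: ltW.
by rewrite ler_pdivrMr// mul1r; lra.
Qed.

Lemma invS_lt (R : realType) (e : R) : 0 < e :> R ->
  exists N, forall n, (N <= n)%N -> n.+1%:R^-1 < e.
Proof.
by move=> e0; have [N _ h] := near_infty_natSinv_lt (PosNum e0); exists N.
Qed.

(** * Orthogonal projection onto a closed subspace *)

Section projection.
Context (R : realType) (H : hilbertType R).

Lemma hilbert_subspaceB (V : set H) x y :
  hilbert_subspace V -> V x -> V y -> V (x - y).
Proof.
by case=> _ VL _ Vx Vy; rewrite -scaleN1r addrC; exact: VL.
Qed.

Lemma nr_parallelogram (a b : H) :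
  nr (a - b) ^+ 2 + nr (a + b) ^+ 2 = 2 * nr a ^+ 2 + 2 * nr b ^+ 2.
Proof.
rewrite -[in a + b](opprK b) !nr_sqB nrN -(sub0r b) innerBr inner0r.
case: (inner a b) => p q /=; ring.
Qed.

(** Comparing [f] with [f - s c y], where [c = <f,y>] and [s = 1 / (1 + |y|^2)], turns minimality
    into [s (1 + s) |c|^2 <= 0]. *)
Lemma minimizer_orthogonal (V : set H) f :
  (forall (a : R[i]) y, V y -> V (a *: y)) ->
  (forall y, V y -> nr f <= nr (f - y)) -> forall y, V y -> inner f y = 0.
Proof.
move=> VZ fmin y Vy; set N := nr y ^+ 2; have N0 : 0 <= N by exact: sqr_ge0.
set c := inner f y; set s := (1 + N)^-1.
have s0 : 0 < s by rewrite invr_gt0; lra.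
have := fmin _ (VZ (s%:C * c) _ Vy).
rewrite -(@ler_pXn2r _ 2)// ?nnegrE ?nr_ge0// nr_sqB nr_sq nr_sq.
rewrite innerZr innerZl innerZr !inner_nr -/N -/c.
case: c => [p q] /= h.
have sN : s * N = 1 - s by rewrite /s; field; lra.
have {}h : s * (p ^+ 2 + q ^+ 2) * (1 + s) <= 0.
  suff -> : s * (p ^+ 2 + q ^+ 2) * (1 + s) =
     2 * (s * (p ^+ 2 + q ^+ 2)) - s * (p ^+ 2 + q ^+ 2) * (s * N) by lra.
  rewrite sN; ring.
have : p ^+ 2 + q ^+ 2 <= 0.
  have s1 : 0 < s * (1 + s) by rewrite mulr_gt0//; lra.
  by rewrite -(pmulr_rle0 _ s1); move: h; congr (_ <= 0); ring.
move=> le0.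
have p0 : p ^+ 2 = 0 by have := sqr_ge0 p; have := sqr_ge0 q; lra.
have q0 : q ^+ 2 = 0 by have := sqr_ge0 q; lra.
by move/eqP: p0; move/eqP: q0; rewrite !sqrf_eq0 => /eqP-> /eqP->.
Qed.

(** A sequence in [V] minimizing the distance to [h] is Cauchy by the parallelogram identity; its
    limit attains the distance, so the residual is orthogonal to [V]. *)
Lemma projection (V : set H) h : hilbert_subspace V ->
  exists2 z, V z & forall y, V y -> inner (h - z) y = 0.
Proof.
move=> hV; have [V0 VL Vc] := hV.
pose S := [set nr (h - y) | y in V]; pose D := inf S.
have infS : has_inf S.
  split; first by exists (nr (h - 0)); exists 0.
  by exists 0 => _ [y _ <-]; exact: nr_ge0.
have DV y : V y -> D <= nr (h - y).
  by move=> Vy; apply: ge_inf; [case: infS|exists y].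
have D0 : 0 <= D.
  by apply: lb_le_inf; [case: infS|move=> _ [y _ <-]; exact: nr_ge0].
have /choice[y yP] n : exists y, V y /\ nr (h - y) < D + n.+1%:R^-1.
  have n0 : 0 < n.+1%:R^-1 :> R by rewrite invr_gt0.
  by have [_ [y Vy <-] yD] := inf_adherent n0 infS; exists y.
have [|z zP] := @nr_complete R H y.
  move=> e e0.
  (* The parallelogram identity bounds [nr (y m - y n) ^+ 2] by [4 ((D + t) ^+ 2 - D ^+ 2)], which
     is at most [4 t (2 D + 1)] because [t <= 1]; the second argument of the minimum keeps this
     within [e ^+ 2]. *)
  pose t := Num.min 1 (e ^+ 2 / (4 * (2 * D + 1))).
  have t0 : 0 < t.
    by rewrite lt_min ltr01/= divr_gt0 ?exprn_gt0//; lra.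
  have t1 : t <= 1 by rewrite ge_min lexx.
  have te : t * (4 * (2 * D + 1)) <= e ^+ 2.
    by rewrite -ler_pdivlMr; [rewrite ge_min lexx orbT|lra].
  have [N NP] := invS_lt t0; exists N => m n Nm Nn.
  (* The midpoint stays in [V], so its distance to [h] is at least [D]. *)
  have mid : V (2^-1 *: (y m + y n)).
    rewrite -[_ *: _]addr0; apply: (VL) => //.
    by rewrite -[y m]scale1r; apply: VL; [exact: (yP m).1|exact: (yP n).1].
  suff : nr (y m - y n) ^+ 2 < e ^+ 2.
    by rewrite ltr_pXn2r// ?nnegrE ?nr_ge0 ?(ltW e0).
  have := nr_parallelogram (h - y m) (h - y n).
  have -> : h - y m - (h - y n) = y n - y m by rewrite opprB addrC -!addrA addKr addrC.
  have -> : h - y m + (h - y n) = 2 *: (h - 2^-1 *: (y m + y n)).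
    rewrite scalerBr scalerA divff ?pnatr_eq0// scale1r scaler_nat mulr2n.
    by rewrite opprD addrACA.
  rewrite nrZ nrB.
  have -> : Re `|2 : R[i]| = 2 by rewrite normr_nat (_ : 2%:R = 2%:C) ?rmorph_nat.
  have [_ ym] := yP m; have [_ yn] := yP n.
  have := NP m Nm; have := NP n Nn; have := DV _ mid.
  have := nr_ge0 (h - y m); have := nr_ge0 (h - y n).
  move: (n.+1%:R^-1) (m.+1%:R^-1) (nr (h - y m)) (nr (h - y n)) (nr (y m - y n))
    (nr (h - 2^-1 *: _)) ym yn.
  move=> a b A B d G Ab Ba; rewrite exprMn => B0 A0 DG at_ bt P.
  have As : A * A <= (D + t) * (D + t) by apply: ler_pM => //; lra.
  have Bs : B * B <= (D + t) * (D + t) by apply: ler_pM => //; lra.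
  have Gs : D * D <= G * G by apply: ler_pM.
  have tt : t * t <= t by apply: ler_piMr; [exact: ltW|].
  rewrite -!expr2 in As Bs Gs; nra.
have Vz : V z.
  apply: closed_nr Vc _ => e /zP[N /(_ N (leqnn N)) zN].
  by exists (y N) => //; exact: (yP N).1.
exists z => //; apply: minimizer_orthogonal => [a v Vv|v Vv].
  by rewrite -[_ *: _]addr0; exact: VL.
rewrite -addrA -opprD.
apply: (@le_trans _ _ D); last by apply: DV; rewrite -[z]scale1r; exact: VL.
apply: (@le_addr_epsilon _ 2) => // e e0.
have [N zN] := zP _ e0; have [N' eN] := invS_lt e0.
have := zN _ (leq_maxl N N'); have := eN _ (leq_maxr N N').
have [_] := yP (maxn N N'); have := nr_tri (y (maxn N N')) h z.
rewrite (nrB z); move: (_^-1) (nr (h - z)) (nr (h - y _)) (nr (y _ - z)) => a b c f; lra.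
Qed.

End projection.

(** * Extension of a bounded map from a dense sequence *)

Section dense_extension.
Context (R : realType) (H : hilbertType R).

Lemma rat_complex_dense (a : R[i]) (e : R) : 0 < e :> R ->
  exists q : rat * rat, Re `|a - (ratr q.1 +i* ratr q.2)| < e.
Proof.
case: a => a b e0.
have e2 : 0 < e / 2 by rewrite divr_gt0.
have [q1 /[!in_itv]/= /andP[q1a q1b]] := rat_in_itvoo (ltr_pwDr e2 (lexx a)).
have [q2 /[!in_itv]/= /andP[q2a q2b]] := rat_in_itvoo (ltr_pwDr e2 (lexx b)).
exists (q1, q2) => /=.
rewrite -[ltRHS]ger0_norm ?ltW// -sqrtr_sqr ltr_sqrt ?exprn_gt0//.
nra.
Qed.

Context (V : set H) (x y : nat -> H) (M : R).
Hypothesis M0 : 0 <= M :> R.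
Hypothesis hV : hilbert_subspace V.
Hypothesis Vy : forall n, V (y n).
Hypothesis xdense : forall h, V h -> forall e : R, 0 < e :> R -> exists n, nr (h - x n) < e.
Hypothesis bound : forall (q : rat * rat) l m n,
  nr (y l - (ratr q.1 +i* ratr q.2) *: y m - y n) <=
  M * nr (x l - (ratr q.1 +i* ratr q.2) *: x m - x n).

Let nr_lin (a : R[i]) (h h' k k' : H) :
  nr (a *: h + k - (a *: h' + k')) <= Re `|a| * nr (h - h') + nr (k - k').
Proof. by rewrite opprD addrACA -scalerBr -nrZ; exact: nrD. Qed.

Let Re_norm_ge0 (a : R[i]) : 0 <= Re `|a|.
Proof. by have := normr_ge0 a; rewrite lecE => /andP[]. Qed.

(** Replacing [a] by a rational scalar within [e] changes the two sides by at most [e * nr (y m)]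
    and [e * (M * nr (x m))]. *)
Let bound_complex (a : R[i]) l m n :
  nr (y l - a *: y m - y n) <= M * nr (x l - a *: x m - x n).
Proof.
apply: (@le_addr_epsilon _ (nr (y m) + M * nr (x m))) => [|e e0].
  by rewrite addr_ge0// ?mulr_ge0 ?nr_ge0.
have [q] := rat_complex_dense a e0; set r := ratr q.1 +i* _ => ar.
have sub u v w : u - a *: v - w - (u - r *: v - w) = (r - a) *: v :> H.
  by rewrite opprB addrA subrK opprB addrC addrA subrK scalerBl.
have := bound q l m n; rewrite -/r.
have := nr_tri (y l - r *: y m - y n) (y l - a *: y m - y n) 0.
have := nr_tri (x l - a *: x m - x n) (x l - r *: x m - x n) 0.
rewrite !subr0 sub (nrB (x l - r *: x m - x n)) sub !nrZ (distrC r).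
have := nr_ge0 (y m); have := nr_ge0 (x m).
move: (nr (y m)) (nr (x m)) (nr (x l - r *: x m - x n)) (nr (y l - r *: y m - y n)) ar
  (nr (y l - a *: y m - y n)) (nr (x l - a *: x m - x n)) (Re_norm_ge0 (a - r)).
move: (Re _) => d Y X Xr Yr de Ya Xa d0 X0 Y0 h1 h2 h3.
have : d * Y <= e * Y by apply: ler_wpM2r => //; exact: ltW.
have : M * Xr <= M * (d * X + Xa) by apply: ler_wpM2l.
have : M * (d * X) <= M * (e * X).
  by apply: ler_wpM2l => //; apply: ler_wpM2r => //; exact: ltW.
lra.
Qed.

Let bound_sub m n : nr (y m - y n) <= M * nr (x m - x n).
Proof. by have := bound_complex 0 m m n; rewrite !scale0r !subr0. Qed.

Let bound1 n : nr (y n) <= M * nr (x n).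
Proof. by have := bound_complex 1 n n n; rewrite !scale1r !subrr !sub0r !nrN. Qed.

(** The value is the limit of [y] along indices whose [x] values tend to [h]; [bound_sub] makes this
    sequence Cauchy, and the estimate against every [n] survives the limit. *)
Let extension_at h : V h ->
  exists2 k, V k & forall n, nr (k - y n) <= M * nr (h - x n).
Proof.
move=> Vh.
have /choice[s sP] n : exists m, nr (h - x m) < n.+1%:R^-1.
  by apply: xdense => //; rewrite invr_gt0.
have xsub m n : nr (x m - x n) <= nr (h - x m) + nr (h - x n).
  by rewrite (nrB h); exact: nr_tri.
have [|k kP] := @nr_complete R H (y \o s).
  move=> e e0; have M1 : 0 < 2 * M + 1 by rewrite ltr_wpDl// mulr_ge0.
  have d0 : 0 < e / (2 * M + 1) by exact: divr_gt0.
  have [N NP] := invS_lt d0; exists N => m n Nm Nn /=.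
  apply: (le_lt_trans (bound_sub _ _)).
  have : nr (x (s m) - x (s n)) <= 2 * (e / (2 * M + 1)).
    have := xsub (s m) (s n); have := lt_trans (sP m) (NP m Nm).
    have := lt_trans (sP n) (NP n Nn).
    move: (e / _) (nr (x _ - _)) (nr (h - _)) (nr (h - _)) => a b c d.  lra.
  move=> /(ler_wpM2l M0)/le_lt_trans; apply.
  by rewrite !mulrA ltr_pdivrMr; nra.
exists k.
  have [_ _ Vc] := hV; apply: closed_nr Vc _ => e /kP[N /(_ N (leqnn N)) kN].
  by exists (y (s N)).
move=> n; apply: (@le_addr_epsilon _ (1 + M)) => [|e e0]. by rewrite addr_ge0.
have [N kN] := kP _ e0; have [N' eN] := invS_lt e0.
pose K := maxn N N'.
have := kN K (leq_maxl _ _); have := lt_trans (sP K) (eN K (leq_maxr _ _)).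
have := ler_wpM2l M0 (nr_tri h (x (s K)) (x n)).
have := bound_sub (s K) n; have := nr_tri (y (s K)) k (y n).
rewrite (nrB (x (s K)) h) /=.
move: (nr (k - y n)) (nr (k - _)) (nr (y _ - _)) (nr (x _ - _)) (nr (h - x n)) (nr (h - _)).
move=> a b c d f g h1 h2 h3 h4 h5.
have : M * g <= M * e by apply: ler_wpM2l => //; exact: ltW.
lra.
Qed.

(** The three-term form of [bound] carries linearity although the range of [x] need not be stable
    under combinations: when [x l] is close to [a *: x m + x n], the same holds for the [y] values,
    and this passes to limits. *)
Lemma dense_extension : exists t : H -> H, [/\
  forall h, V h -> V (t h),
  forall (a : R[i]) h k, V h -> V k -> t (a *: h + k) = a *: t h + t k,
  forall h, V h -> nr (t h) <= M * nr h &
  forall h, V h -> forall n, nr (t h - y n) <= M * nr (h - x n)].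
Proof.
have /choice[t tP] h : exists k, V h -> V k /\ forall n, nr (k - y n) <= M * nr (h - x n).
  have [Vh|nVh] := pselect (V h); last by exists 0.
  by have [k Vk kP] := extension_at Vh; exists k.
exists t; split.
- by move=> h /tP[].
- move=> a h k Vh Vk.
  have Vahk : V (a *: h + k) by case: hV => _ VL _; exact: VL.
  apply: nr_eq_lim => e e0.
  set A := Re `|a|; have A0 : 0 <= A by exact: Re_norm_ge0.
  (* The errors below are [M d], [M (d + (A d + d))] and [A M d + M d], with sum [2 M (2 + A) d];
     the [+ 1] keeps the denominator positive. *)
  pose d := e / (2 * M * (2 + A) + 1).
  have MA : 0 <= M * A by rewrite mulr_ge0.
  have D0 : 0 < 2 * M * (2 + A) + 1 by rewrite ltr_wpDl// !mulr_ge0// addr_ge0.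
  have d0 : 0 < d by exact: divr_gt0.
  have [l lP] := xdense Vahk d0; have [m mP] := xdense Vh d0.
  have [n nP] := xdense Vk d0.
  have tl := (tP _ Vahk).2 l; have tm := (tP _ Vh).2 m; have tn := (tP _ Vk).2 n.
  have ylmn := bound_complex a l m n; rewrite -!addrA -!opprD in ylmn.
  have xX : nr (x l - (a *: x m + x n)) <= d + (A * d + d).
    apply: (le_trans (nr_tri (a *: h + k) _ _)); apply: lerD; first by rewrite nrB ltW.
    apply: (le_trans (nr_lin _ _ _ _ _)); apply: lerD; last exact: ltW.
    by apply: ler_wpM2l => //; exact: ltW.
  have tY : nr (a *: t h + t k - (a *: y m + y n)) <= A * (M * d) + M * d.
    apply: (le_trans (nr_lin _ _ _ _ _)); apply: lerD.
      apply: ler_wpM2l => //; apply: (le_trans tm).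
      by apply: ler_wpM2l => //; exact: ltW.
    by apply: (le_trans tn); apply: ler_wpM2l => //; exact: ltW.
  have {}tl : nr (t (a *: h + k) - y l) <= M * d.
    by apply: (le_trans tl); apply: ler_wpM2l => //; exact: ltW.
  have {}ylmn := le_trans ylmn (ler_wpM2l M0 xX).
  have de : 2 * M * (2 + A) * d <= e.
    rewrite /d mulrCA; apply: ler_piMr; first exact: ltW.
    by rewrite ler_pdivrMr// mul1r lerDl.
  apply: le_trans de.
  apply: (le_trans (nr_tri (y l) _ _)).
  apply: (le_trans (lerD tl (nr_tri (a *: y m + y n) _ _))).
  rewrite [X in _ + (_ + X)]nrB; apply: (le_trans (lerD (lexx _) (lerD ylmn tY))).
  by rewrite le_eqVlt; apply/orP; left; apply/eqP; ring.
- move=> h Vh; apply: (@le_addr_epsilon _ (2 * M)) => [|e e0]; first by rewrite mulr_ge0.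
  have [n xn] := xdense Vh e0; have := (tP _ Vh).2 n.
  have := ler_wpM2l M0 (ltW xn).
  have := nr_tri (y n) (t h) 0; have := ler_wpM2l M0 (nr_tri h (x n) 0).
  have := bound1 n; rewrite !subr0 (nrB (x n)).
  move: (nr (h - _)) (nr h) (nr (t h)) (nr (t h - _)) (nr (x n)) (nr (y n)) => a b c d f g.
  lra.
- by move=> h /tP[].
Qed.

End dense_extension.

Section approximated.
Context (R : realType) (H : hilbertType R) (s : nat -> H).

(** This is the closure of the range of [s], phrased with the real-valued norm. *)
Definition approximated : set H :=
  [set h | forall e : R, 0 < e :> R -> exists n, nr (h - s n) < e].

Lemma closed_approximated : closed approximated.
Proof.
move=> h /closure_nr hC e e0.
have e2 : 0 < e / 2 by rewrite divr_gt0.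
have [z zC hz] := hC _ e2; have [n zn] := zC _ e2; exists n.
by apply: (le_lt_trans (nr_tri z _ _)); rewrite [ltRHS]splitr ltrD.
Qed.

Lemma hilbert_subspace_approximated :
  (forall (q : rat * rat) m n, approximated ((ratr q.1 +i* ratr q.2) *: s m + s n)) ->
  hilbert_subspace approximated.
Proof.
move=> sq; split; last exact: closed_approximated.
  (* Zero is obtained as the rational combination [- s 0 + s 0]. *)
  have := sq (-1, 0) 0%N 0%N.
  rewrite /= rmorph0 rmorphN rmorph1 (_ : (-1) +i* 0 = -1) ?scaleN1r ?addNr//.
  by apply/eqP; rewrite eq_complex /= oppr0 !eqxx.
move=> a x y xC yC.
apply: closed_nr closed_approximated _ => e e0.
have e4 : 0 < e / 4 by rewrite divr_gt0.
have Re0 (b : R[i]) : 0 <= Re `|b| by have := normr_ge0 b; rewrite lecE => /andP[].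
have a1 : 0 < Re `|a| + 1 by rewrite ltr_wpDl.
(* The error splits into [a (x - s m)], [(a - r) s m] and [y - s n]; the tolerances make each of
   them at most [e / 4]. *)
have [m xm] := xC _ (divr_gt0 e4 a1); have [n yn] := yC _ e4.
have m1 : 0 < nr (s m) + 1 by rewrite ltr_wpDl// nr_ge0.
have [q aq] := rat_complex_dense a (divr_gt0 e4 m1).
exists ((ratr q.1 +i* ratr q.2) *: s m + s n) => //.
set r := ratr q.1 +i* _ in aq *.
have -> : a *: x + y - (r *: s m + s n) = a *: (x - s m) + (a - r) *: s m + (y - s n).
  by rewrite opprD addrACA; congr (_ + _); rewrite scalerBr scalerBl addrA subrK.
apply: (le_lt_trans (nrD _ _)).
have -> : e = e / 4 + e / 4 + e / 2 by field.
apply: ltrD; last by apply: (lt_trans yn); rewrite ltr_pM2l// ltf_pV2 ?posrE// ltr_nat.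
apply: (le_lt_trans (nrD _ _)); rewrite !nrZ.
apply: ler_ltD.
  have := ler_wpM2l (Re0 a) (ltW xm); move/le_trans; apply.
  rewrite mulrCA; apply: ler_piMr; first exact: ltW.
  by rewrite ler_pdivrMr// mul1r lerDl.
have := ler_wpM2r (nr_ge0 (s m)) (ltW aq); move/le_lt_trans; apply.
by rewrite mulrAC ltr_pdivrMr// ltr_pM2l// ltrDl.
Qed.

End approximated.

(** * Integration for a complete measure *)

Section measure_lemmas.
Context d (X : measurableTopologicalType d) (R : realType).
Variable mu : {measure set X -> \bar R}.

(** A measurable null set [N] lies in a Borel set [C] with [C] minus some Borel [B] inside [N] null,
    so [C] is null. Any subset of [N] is then squeezed between the empty set and [C]. *)
Lemma borel_completion_complete : borel_completion mu -> measure_is_complete mu.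
Proof.
move=> hmu A [N [mN N0 AN]].
have borel C : (<<s @open X >>) C -> measurable C.
  by move=> bC; apply/hmu; exists C, C; split=> //; rewrite setDv measure0.
have [B [C [bB bC BN NC CB0]]] := (hmu N).1 mN.
apply/hmu; exists set0, C; split=> //.
- exact: sigma_algebra0.
- exact: subset_trans AN NC.
rewrite setD0; apply: (@measure_negligible _ _ _ mu); first exact: borel.
apply: (@negligibleS _ _ _ mu ((C `\` B) `|` N)).
  by move=> x Cx; have [Bx|nBx] := pselect (B x); [right; exact: BN|left].
apply: negligibleU; last by exists N; split.
by exists (C `\` B); split=> //; apply: measurableD; apply: borel.
Qed.

Lemma counting_ae : is_counting_measure mu -> forall P : X -> Prop,
  {ae mu, forall p, P p} -> forall p, P p.
Proof.
move=> cmu P [N [mN N0 PN]] p; apply: contrapT => nPp.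
have Np : N p by apply: PN.
move: N0; rewrite cmu// /counting; case: asboolP => // finN [] /eqP.
by rewrite pnatr_eq0 finmap.cardfs_eq0 => /eqP/fset_set_set0 -/(_ finN) N0; rewrite N0 in Np.
Qed.

End measure_lemmas.

Section complete_measure.
Context d (X : measurableType d) (R : realType).
Variable mu : {measure set X -> \bar R}.
Hypothesis cmu : measure_is_complete mu.

Implicit Types (f g : X -> R).

(** Completeness of the measure makes [g] measurable. *)
Lemma integrable_ae_eq f g : {ae mu, forall p, f p = g p} ->
  mu.-integrable setT (EFin \o f) -> mu.-integrable setT (EFin \o g).
Proof.
move=> fg /integrableP[mf foo].
have fgE : ae_eq mu setT (EFin \o f) (EFin \o g).
  by apply: filterS fg => p /= ->.
have mg := ae_measurable_fun cmu fgE mf.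
apply/integrableP; split=> //.
suff <- : (\int[mu]_p `|(EFin \o f) p| = \int[mu]_p `|(EFin \o g) p|)%E by [].
apply: ae_eq_integral => //; last exact: ae_eq_abse.
- exact: (measurableT_comp _ mf).
- exact: (measurableT_comp (@measurable_realfun.abse_measurable R setT) mg).

Qed.

Lemma Rintegral_ae_eq f g : {ae mu, forall p, f p = g p} ->
  mu.-integrable setT (EFin \o f) -> \int[mu]_p f p = \int[mu]_p g p.
Proof.
move=> fg fi; have gi := integrable_ae_eq fg fi.
rewrite /Rintegral; congr fine; apply: ae_eq_integral => //.
- exact: measurable_int fi.
- exact: measurable_int gi.
- by apply: filterS fg => p /= ->.
Qed.

Lemma Rintegral_eq0_ae f : (forall p, 0 <= f p :> R) ->
  mu.-integrable setT (EFin \o f) -> \int[mu]_p f p <= 0 ->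
  {ae mu, forall p, f p = 0}.
Proof.
move=> f0 fi If.
have /(ae_eq_integral_abs mu measurableT (measurable_int _ fi)) :
    (\int[mu]_p `|(EFin \o f) p| = 0)%E.
  under eq_integral do rewrite /= ger0_norm//.
  have If0 : \int[mu]_p f p = 0 by apply/eqP; rewrite eq_le If Rintegral_ge0.
  by rewrite -[LHS]fineK; [rewrite -/(Rintegral _ _ _) If0|exact: integrable_fin_num].
by apply: filterS => p /(_ I) [].
Qed.

Lemma integrable_indicM f A : measurable A ->
  mu.-integrable setT (EFin \o f) -> mu.-integrable setT (EFin \o (fun p => \1_A p * f p)).
Proof.
move=> mA fi.
have /(integrable_mkcond (EFin \o f) mA) : mu.-integrable A (EFin \o f).
  exact: integrableS fi.
apply: eq_integrable => // p _; rewrite /= patchE indicE.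
by case: (p \in A); rewrite ?mul1r ?mul0r.
Qed.

(** Testing with the set where [f] is negative gives a nonnegative function [- 1_A f] with
    nonpositive integral, hence null almost everywhere. *)
Lemma Rintegral_ge0_ae f : mu.-integrable setT (EFin \o f) ->
  (forall A, measurable A -> 0 <= \int[mu]_p (\1_A p * f p) :> R) ->
  {ae mu, forall p, 0 <= f p}.
Proof.
move=> fi hA.
pose A := [set p | f p < 0].
have mf : measurable_fun setT f by apply/measurable_EFinP; exact: measurable_int fi.
have mA : measurable A.
  have := mf measurableT `]-oo, 0[%classic (measurable_itv _); rewrite setTI.
  by congr measurable; apply/seteqP; split=> p /=; rewrite in_itv.
pose g p := - (\1_A p * f p).
have g0 p : 0 <= g p :> R.
  rewrite /g indicE; case: (boolP (p \in A)) => [/set_mem Ap|_].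
    by rewrite mul1r oppr_ge0 ltW.
  by rewrite mul0r oppr0.
have hi := integrable_indicM mA fi.
have gi : mu.-integrable setT (EFin \o g).
  exact: integrableN hi.
have := Rintegral_eq0_ae g0 gi.
have -> : \int[mu]_p g p = - \int[mu]_p (\1_A p * f p).
  rewrite -[RHS]mulN1r -RintegralZl//.
  by apply: eq_Rintegral => p _; rewrite mulN1r.
rewrite oppr_le0 => /(_ (hA A mA)); apply: filterS => p.
rewrite /g indicE; case: (boolP (p \in A)) => [/set_mem Ap|]; last first.
  by rewrite notin_setE /A /= => /negP; rewrite -leNgt.
by rewrite mul1r => /eqP; rewrite oppr_eq0 => /eqP ->.
Qed.

(* Markov: the set where all f n are >= e has measure at most inf_n (int f n) / e. *)
Lemma ae_small (f : nat -> X -> R) : (forall n p, 0 <= f n p :> R) ->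
  (forall n, mu.-integrable setT (EFin \o f n)) ->
  (forall e : R, 0 < e :> R -> exists n, \int[mu]_p f n p < e) ->
  {ae mu, forall p, forall e : R, 0 < e :> R -> exists n, f n p < e}.
Proof.
move=> f0 fi fsmall.
(* Countably many tolerances suffice, so each may have its own null set. *)
suff: {ae mu, forall p, forall j : nat, exists n, f n p < j.+1%:R^-1}.
  apply: filterS => p fp e e0; have [N Ne] := invS_lt e0.
  by have [n fn] := fp N; exists n; exact: lt_trans fn (Ne N _).
apply: ae_foralln => j.
set e : R := j.+1%:R^-1; have e0 : 0 < e by rewrite invr_gt0.
pose A n := [set: X] `&` [set p | (e%:E <= `|(EFin \o f n) p|)%E].
have mA n : measurable (A n).
  apply: emeasurable_fun_c_infty => //; apply: measurableT_comp => //.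
  exact: measurable_int (fi n).
exists (\bigcap_n A n); split.
- exact: bigcapT_measurable.
- apply/eqP; rewrite -measure_le0 -(@pmule_rle0 _ e%:E) ?lte_fin//.
  apply/lee_addgt0Pr => t t0; rewrite add0e.
  have [n fn] := fsmall t t0.
  apply: (@le_trans _ _ (e%:E * mu (A n))%E).
    apply: lee_wpmul2l; first by rewrite lee_fin ltW.
    apply: le_measure; rewrite ?inE//; first exact: bigcapT_measurable.
    by move=> p; apply.
  apply: (le_trans (le_integral_abse mu measurableT (measurable_int _ (fi n)) e0)).
  rewrite (eq_integral (EFin \o f n)) => [|p _]; last by rewrite /= ger0_norm.
  rewrite -[leLHS]fineK; last exact: integrable_fin_num.
  by rewrite lee_fin ltW.
- move=> p /= nfp n _; split=> //=; rewrite lee_fin ger0_norm// leNgt.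
  by apply/negP => fn; apply: nfp; exists n.
Qed.

End complete_measure.

(** * Integrals of complex-valued functions *)

Section complex_integrals.
Context d (X : measurableTopologicalType d) (R : realType).
Variable mu : {measure set X -> \bar R}.
Implicit Types (f g : X -> R[i]) (a : R[i]).

Lemma cintegrable_ae_eq f g : measure_is_complete mu ->
  {ae mu, forall p, f p = g p} -> cintegrable mu f -> cintegrable mu g.
Proof.
move=> cmu fg [fr fi]; split.
- by apply: (integrable_ae_eq cmu _ fr); apply: filterS fg => p ->.
- by apply: (integrable_ae_eq cmu _ fi); apply: filterS fg => p ->.
Qed.

Lemma cintegral_ae_eq f g : measure_is_complete mu ->
  {ae mu, forall p, f p = g p} -> cintegrable mu f -> cintegral mu f = cintegral mu g.
Proof.
move=> cmu fg [fr fi]; congr Complex.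
- by apply: (Rintegral_ae_eq cmu _ fr); apply: filterS fg => p ->.
- by apply: (Rintegral_ae_eq cmu _ fi); apply: filterS fg => p ->.
Qed.

Let integrable_comb (s t : R) (u v w : X -> R) :
  mu.-integrable setT (EFin \o u) -> mu.-integrable setT (EFin \o v) ->
  mu.-integrable setT (EFin \o w) ->
  mu.-integrable setT (EFin \o (fun p => s * u p + t * v p + w p)).
Proof.
move=> ui vi wi.
exact: (integrableD measurableT (integrableD measurableT
  (integrableZl measurableT s ui) (integrableZl measurableT t vi)) wi).
Qed.

Let Rintegral_comb (s t : R) (u v w : X -> R) :
  mu.-integrable setT (EFin \o u) -> mu.-integrable setT (EFin \o v) ->
  mu.-integrable setT (EFin \o w) ->
  \int[mu]_p (s * u p + t * v p + w p) =
  s * \int[mu]_p u p + t * \int[mu]_p v p + \int[mu]_p w p.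
Proof.
move=> ui vi wi.
have si := integrableZl measurableT s ui.
have ti := integrableZl measurableT t vi.
rewrite RintegralD//; last exact: (integrableD measurableT si ti).
by rewrite RintegralD// !RintegralZl.
Qed.

Let lin_ReIm a f g p : a * f p + g p =
  (Re a * Re (f p) + - Im a * Im (f p) + Re (g p)) +i*
  (Im a * Re (f p) + Re a * Im (f p) + Im (g p)).
Proof.
by case: a (f p) (g p) => [a b] [c e] [k l]; congr Complex => /=; ring.
Qed.

Lemma cintegrable_lin a f g : cintegrable mu f -> cintegrable mu g ->
  cintegrable mu (fun p => a * f p + g p).
Proof.
move=> [fr fi] [gr gi]; split.
- under eq_fun do rewrite lin_ReIm /=; exact: integrable_comb.
- under eq_fun do rewrite lin_ReIm /=; exact: integrable_comb.
Qed.

Lemma cintegral_lin a f g : cintegrable mu f -> cintegrable mu g ->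
  cintegral mu (fun p => a * f p + g p) = a * cintegral mu f + cintegral mu g.
Proof.
move=> [fr fi] [gr gi]; rewrite /cintegral.
under eq_Rintegral do rewrite lin_ReIm /=.
under [X in _ +i* X]eq_Rintegral do rewrite lin_ReIm /=.
rewrite !Rintegral_comb//.
by case: a => [a b]; congr Complex => /=; ring.
Qed.

Lemma cintegrable_indicM A f : measurable A -> cintegrable mu f ->
  cintegrable mu (fun p => (\1_A p)%:C * f p).
Proof.
move=> mA [fr fi]; split.
- have := integrable_indicM mA fr; congr integrable.
  by apply/funext => p /=; case: (f p) => a b /=; rewrite mul0r subr0.
- have := integrable_indicM mA fi; congr integrable.
  by apply/funext => p /=; case: (f p) => a b /=; rewrite mul0r addr0.
Qed.

End complex_integrals.

(** * Sections of a direct integral *)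

Section direct_integral_sections.
Context d (X : measurableTopologicalType d) (R : realType).
Variable mu : {measure set X -> \bar R}.
Hypothesis cmu : measure_is_complete mu.
Context (H : X -> hilbertType R) (K : hilbertType R) (ev : K -> forall p, H p).

(* In contrast with direct_integral, the values of x in W lie in V p only almost
   everywhere, so that the same ev serves all the members of the system E. *)
Definition ae_direct_integral (V : forall p, set (H p)) (W : set K) :=
  [/\ hilbert_subspace W,
      forall x, W x -> {ae mu, forall p, V p (ev x p)} &
      forall w : forall p, H p, (forall p, V p (w p)) ->
        (forall y, W y -> cintegrable mu (fun p => inner (w p) (ev y p))) ->
        exists2 x, W x & {ae mu, forall p, ev x p = w p}].

Hypothesis ev_inner : forall x y,
  cintegrable mu (fun p => inner (ev x p) (ev y p)) /\
  inner x y = cintegral mu (fun p => inner (ev x p) (ev y p)).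
Hypothesis evK : ae_direct_integral (fun p => setT) setT.

Lemma integrable_nr2 x : mu.-integrable setT (EFin \o (fun p => nr (ev x p) ^+ 2)).
Proof.
have [[h _] _] := ev_inner x x.
by move: h; congr integrable; apply/funext => p /=; rewrite nr_sq.
Qed.

Lemma Rintegral_nr2 x : \int[mu]_p (nr (ev x p) ^+ 2) = nr x ^+ 2.
Proof.
have [_ h] := ev_inner x x; rewrite nr_sq h /=.
by apply: eq_Rintegral => p _; rewrite nr_sq.
Qed.

(** [ev] is not assumed linear, so the zero vector is handled through the integral of [|ev x|^2],
    which vanishes. *)
Lemma ev0_ae x : x = 0 -> {ae mu, forall p, ev x p = 0}.
Proof.
move=> x0; have := Rintegral_eq0_ae (fun p => sqr_ge0 (nr (ev x p))) (integrable_nr2 x).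
rewrite Rintegral_nr2 x0 nr0 expr0n => /(_ (lexx _)).
by apply: filterS => p /eqP; rewrite sqrf_eq0 => /eqP/nr_eq0.
Qed.

Lemma ev_ae0 x : {ae mu, forall p, ev x p = 0} -> x = 0.
Proof.
move=> x0; apply: nr_eq0; apply/eqP; rewrite -sqrf_eq0 -Rintegral_nr2.
rewrite -(Rintegral_ae_eq cmu (f := fun=> 0)).
- by rewrite Rintegral_cst//= mul0r.
- by apply: filterS x0 => p ->; rewrite nr0 expr0n.
- exact: integrable0.
Qed.

(** The selection property represents [w] by some [x] in [W], and pairing [w] with this very [x]
    gives [|x|^2 = 0]. *)
Lemma section_eq0 V W w : ae_direct_integral V W -> (forall p, V p (w p)) ->
  (forall y, W y -> cintegrable mu (fun p => inner (w p) (ev y p)) /\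
    cintegral mu (fun p => inner (w p) (ev y p)) = 0) ->
  {ae mu, forall p, w p = 0}.
Proof.
move=> [_ _ sel] Vw w0.
have [x Wx xw] := sel _ Vw (fun y Wy => (w0 y Wy).1).
suff x0 : {ae mu, forall p, ev x p = 0} by apply: filterS2 xw x0 => p ->.
apply: ev0_ae; apply: nr_eq0; apply/eqP; rewrite -sqrf_eq0 nr_sq.
have [wi wI] := w0 _ Wx; have [xi ->] := ev_inner x x.
rewrite (cintegral_ae_eq (g := fun p => inner (w p) (ev x p)) cmu _ xi) ?wI//.
by apply: filterS xw => p ->.
Qed.

Lemma orthogonal_section_eq0 V W w : ae_direct_integral V W -> (forall p, V p (w p)) ->
  (forall y, W y -> {ae mu, forall p, inner (w p) (ev y p) = 0}) ->
  {ae mu, forall p, w p = 0}.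
Proof.
move=> VW Vw w0; apply: (section_eq0 VW Vw) => y Wy.
have c0 : cintegrable mu (fun=> 0 : R[i]) by split; exact: integrable0.
have w0y : {ae mu, forall p, 0 = inner (w p) (ev y p)}.
  by apply: filterS (w0 y Wy) => p ->.
split; first exact: (cintegrable_ae_eq cmu w0y c0).
rewrite -(cintegral_ae_eq cmu w0y c0) /cintegral /=.
by rewrite Rintegral_cst//= mul0r.
Qed.

(** The defect of linearity is a section whose pairing with any [z] integrates to a combination of
    inner products in [K] that cancels, so [section_eq0] applies. *)
Lemma ev_lin (a : R[i]) x y : {ae mu, forall p, ev (a *: x + y) p = a *: ev x p + ev y p}.
Proof.
pose w p := ev (a *: x + y) p - (a *: ev x p + ev y p).
have : {ae mu, forall p, w p = 0}.
  apply: (section_eq0 evK) => // z _.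
  have [xi xI] := ev_inner x z; have [yi yI] := ev_inner y z.
  have [zi zI] := ev_inner (a *: x + y) z.
  have wE : (fun p => inner (w p) (ev z p)) =
    (fun p => -1 * (a * inner (ev x p) (ev z p) + inner (ev y p) (ev z p)) +
       inner (ev (a *: x + y) p) (ev z p)).
    by apply/funext => p; rewrite innerBl innerDl innerZl mulN1r addrC.
  have li := cintegrable_lin a xi yi.
  rewrite wE; split; first exact: cintegrable_lin.
  rewrite cintegral_lin// cintegral_lin// -xI -yI -zI innerDl innerZl.
  by rewrite mulN1r addNr.
by apply: filterS => p /eqP; rewrite subr_eq0 => /eqP.
Qed.

Lemma ev_sub x y : {ae mu, forall p, ev (x - y) p = ev x p - ev y p}.
Proof.
have := ev_lin (-1) y x; apply: filterS => p.
by rewrite !scaleN1r ![- _ + _]addrC.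
Qed.

Lemma ev_inj x y : {ae mu, forall p, ev x p = ev y p} -> x = y.
Proof.
move=> xy; apply: subr0_eq; apply: ev_ae0.
by apply: filterS2 xy (ev_sub x y) => p -> ->; rewrite subrr.
Qed.

Lemma cut_exists V W A u : ae_direct_integral V W -> (forall p, V p 0) ->
  measurable A -> W u ->
  exists2 x, W x & {ae mu, forall p, ev x p = (\1_A p)%:C *: ev u p}.
Proof.
move=> [_ VW sel] V0 mA Wu.
(* Selection asks for membership in [V p] at every point, whereas [ev u p] has it only almost
   everywhere; hence the default 0. *)
pose w p := if pselect (V p (ev u p) /\ A p) then ev u p else 0.
have wE : {ae mu, forall p, w p = (\1_A p)%:C *: ev u p}.
  apply: filterS (VW _ Wu) => p Vp; rewrite /w indicE.
  case: pselect => /=; first by move=> [_ Ap]; rewrite mem_set// scale1r.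
  by move=> nA; rewrite memNset ?scale0r// => Ap; apply: nA.
have [p|y Wy|x Wx xw] := sel w.
- by rewrite /w; case: pselect => //= -[].
- have := cintegrable_indicM mA (ev_inner u y).1.
  apply: cintegrable_ae_eq => //; apply: filterS wE => p ->.
  by rewrite innerZl.
- by exists x => //; apply: filterS2 xw wE => p ->.
Qed.

(** * Values of a dense sequence in the fibres *)

Section dense_sequence.
Context (V : forall p, set (H p)) (W : set K) (s : nat -> K).
Arguments V : clear implicits.
Hypothesis VW : ae_direct_integral V W.
Hypothesis hV : forall p, hilbert_subspace (V p).
Hypothesis Ws : forall n, W (s n).
Hypothesis s_dense : W `<=` approximated s.

(** The integral of [|ev (y - s n)|^2] is [|y - s n|^2], which is arbitrarily small; [ae_small]
    makes this pointwise. *)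
Lemma ev_approximated y : W y ->
  {ae mu, forall p, approximated (fun n => ev (s n) p) (ev y p)}.
Proof.
move=> Wy.
have small : {ae mu, forall p, forall e : R, 0 < e :> R ->
    exists n, nr (ev (y - s n) p) ^+ 2 < e}.
  apply: ae_small => [n p|n|e e0]; [exact: sqr_ge0|exact: integrable_nr2|].
  have m0 : 0 < Num.min 1 e by rewrite lt_min ltr01.
  have [n yn] := s_dense Wy m0; exists n.
  rewrite Rintegral_nr2; move: yn; rewrite lt_min => /andP[y1 ye].
  apply: le_lt_trans ye; rewrite expr2; apply: ler_piMr; [exact: nr_ge0|exact: ltW].
have sub : {ae mu, forall p, forall n, ev (y - s n) p = ev y p - ev (s n) p}.
  by apply: ae_foralln => n; exact: ev_sub.
apply: filterS2 small sub => p hp sp e e0.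
have [n yn] := hp (e ^+ 2) (exprn_gt0 2 e0); exists n.
by rewrite -sp; move: yn; rewrite ltr_pXn2r// nnegrE ?nr_ge0// ltW.
Qed.

Lemma ev_approximated_subspace :
  {ae mu, forall p, hilbert_subspace (approximated (fun n => ev (s n) p))}.
Proof.
have [[_ WL _] _ _] := VW.
(* Pairs of rationals are enumerated by their codes [k], so that [ae_foralln] covers them. *)
have : {ae mu, forall p, forall m n k : nat, forall q, unpickle k = Some q ->
    approximated (fun n => ev (s n) p) ((ratr q.1 +i* ratr q.2) *: ev (s m) p + ev (s n) p)}.
  apply: ae_foralln => m; apply: ae_foralln => n; apply: ae_foralln => k.
  case: (unpickle k) => [q|]; last exact: aeW.
  have Wq : W ((ratr q.1 +i* ratr q.2) *: s m + s n) by exact: WL.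
  apply: filterS2 (ev_approximated Wq) (ev_lin (ratr q.1 +i* ratr q.2) (s m) (s n)).
  by move=> p hp eqp q' [<-]; rewrite -eqp.
apply: filterS => p hp; apply: hilbert_subspace_approximated => q m n.
by apply: (hp m n (pickle q)); rewrite pickleK.
Qed.

(* If the values of s failed to be total in V p, a nonzero vector w p could be
   chosen in V p orthogonal to all of them; by the selection property, w would
   be a.e. an element of W orthogonal to W. *)
Lemma ae_dense : {ae mu, forall p, V p `<=` approximated (fun n => ev (s n) p)}.
Proof.
pose bad p v := [/\ V p v, v <> 0 & forall n, inner v (ev (s n) p) = 0].
have ex p : exists v, V p v /\
    ((exists v', bad p v') -> v <> 0) /\ forall n, inner v (ev (s n) p) = 0.
  have [[v [Vv v0 vs]]|nb] := pselect (exists v', bad p v').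
    by exists v.
  exists 0; have [V0 _ _] := hV p.
  by split=> //; split=> // n; rewrite inner0l.
pose w p := sval (cid (ex p)); have wP p := svalP (cid (ex p)).
have w0 : {ae mu, forall p, w p = 0}.
  apply: (orthogonal_section_eq0 VW) => [p|y Wy]; first exact: (wP p).1.
  apply: filterS (ev_approximated Wy) => p yp.
  apply: inner_eq0_lim => e /yp[n yn].
  by exists (ev (s n) p) => //; exact: (wP p).2.2.
have Vs : {ae mu, forall p, forall n, V p (ev (s n) p)}.
  by apply: ae_foralln => n; have [_ + _] := VW; exact.
apply: filterS3 w0 Vs ev_approximated_subspace => p wp0 Vsp asp h Vh.
(* The residual [h - z] would be a bad vector if nonzero, while [w p = 0] excludes bad vectors at
   [p]. *)
have [z zC hz] := projection h asp.
have sC n : approximated (fun n => ev (s n) p) (ev (s n) p).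
  by move=> e e0; exists n; rewrite subrr nr0.
have [_ [wbad _]] := wP p.
have hz0 : h - z = 0.
  apply: contrapT => hz0; apply: (wbad _ wp0); exists (h - z); split=> //.
    apply: hilbert_subspaceB => //.
    have [_ _ Vc] := hV p; apply: closed_nr Vc _ => e /zC[n zn].
    by exists (ev (s n) p).
  by move=> n; exact: hz.
by rewrite (subr0_eq hz0).
Qed.

End dense_sequence.

(** The fibrewise projections of [x] pair with each [y] in [W] almost everywhere as [x] does, so
    integrability is inherited from [x] and selection applies. *)
Lemma projection_section V W x : ae_direct_integral V W ->
  (forall p, hilbert_subspace (V p)) ->
  exists2 z, W z & {ae mu, forall p, forall y, V p y -> inner (ev x p - ev z p) y = 0}.
Proof.
move=> [_ VW sel] hV.
have ex p : exists v, V p v /\ forall y, V p y -> inner (ev x p - v) y = 0.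
  by have [v Vv vP] := projection (ev x p) (hV p); exists v.
pose w p := sval (cid (ex p)); have wP p := svalP (cid (ex p)).
have [p|y Wy|z Wz zw] := sel w.
- exact: (wP p).1.
- apply: cintegrable_ae_eq (ev_inner x y).1 => //.
  apply: filterS (VW _ Wy) => p Vy.
  by apply/subr0_eq; rewrite -innerBl; exact: (wP p).2.
- exists z => //; apply: filterS zw => p ->; exact: (wP p).2.
Qed.

End direct_integral_sections.

(** * Decomposition of operators commuting with indicator functions *)

Lemma approximating_sequence (R : realType) (K : hilbertType R) (W : set K) :
  W 0 -> separable_set W ->
  exists s : nat -> K, (forall n, W (s n)) /\ W `<=` approximated s.
Proof.
move=> W0 [A [cA AW WA]].
have [x0 Ax0] : exists x, A x.
  by have [x [Ax _]] := WA 0 W0 setT filterT; exists x.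
have /countable_injP[g gA] := cA.
(* [s] inverts the injection [g] on its image; other indices receive [x0]. *)
have /choice[s sP] n : exists z, A z /\ ((exists2 z', A z' & g z' = n) -> g z = n).
  have [[z Az zn]|nz] := pselect (exists2 z', A z' & g z' = n); first by exists z.
  by exists x0.
exists s; split=> [n|x Wx e e0]; first by apply: AW; exact: (sP n).1.
have [z Az xz] := closure_nr (WA x Wx) e0.
have [As sz] := sP (g z); exists (g z).
suff -> : s (g z) = z by [].
by apply: gA; rewrite ?inE//; apply: sz; exists z.
Qed.

Section decomposition.
Context d (X : measurableTopologicalType d) (R : realType).
Variable mu : {measure set X -> \bar R}.
Hypothesis cmu : measure_is_complete mu.
Context (H : X -> hilbertType R) (K : hilbertType R) (ev : K -> forall p, H p).
Hypothesis ev_inner : forall x y,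
  cintegrable mu (fun p => inner (ev x p) (ev y p)) /\
  inner x y = cintegral mu (fun p => inner (ev x p) (ev y p)).
Hypothesis evK : ae_direct_integral mu ev (fun p => setT) setT.
Context (V : forall p, set (H p)) (W : set K).
Arguments V : clear implicits.
Hypothesis VW : ae_direct_integral mu ev V W.
Hypothesis hV : forall p, hilbert_subspace (V p).

(** With [z] the fibrewise projection of [u], [<z,z> = <u,z> = 0], so [z] vanishes and [ev u p]
    equals its own residual almost everywhere. The converse is integration. *)
Lemma orthogonal_aeP u : (forall y, W y -> inner u y = 0) <->
  {ae mu, forall p, forall y, V p y -> inner (ev u p) y = 0}.
Proof.
split=> [uW|uV y Wy].
  have [z Wz zP] := projection_section cmu ev_inner u VW hV.
  have z0 : z = 0.
    apply: nr_eq0; apply/eqP; rewrite -sqrf_eq0 nr_sq (ev_inner z z).2.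
    rewrite -(cintegral_ae_eq cmu _ (ev_inner u z).1).
      by rewrite -(ev_inner u z).2 uW.
    have [_ VWz _] := VW; apply: filterS2 zP (VWz z Wz) => p zp Vz.
    by apply/subr0_eq; rewrite -innerBl; exact: zp.
  apply: filterS2 zP (ev0_ae ev_inner z0) => p + ez.
  by rewrite ez subr0.
have [_ VWy _] := VW.
rewrite (ev_inner u y).2 (cintegral_ae_eq (g := fun=> 0) cmu _ (ev_inner u y).1).
  by rewrite /cintegral /= Rintegral_cst//= mul0r.
by apply: filterS2 uV (VWy y Wy) => p uV Vy; exact: uV.
Qed.

Context (T : K -> K) (M : R).
Hypothesis M0 : 0 <= M :> R.
Hypothesis TW : forall x, W x -> W (T x).
Hypothesis Tlin : forall (a : R[i]) x y, W x -> W y -> T (a *: x + y) = a *: T x + T y.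
Hypothesis TM : forall x, W x -> nr (T x) <= M * nr x.
Hypothesis Tcut : forall A u x, measurable A -> W u -> W x ->
  {ae mu, forall p, ev x p = (\1_A p)%:C *: ev u p} ->
  {ae mu, forall p, ev (T x) p = (\1_A p)%:C *: ev (T u) p}.

Lemma nr_indicZ (A : set X) p (v : H p) :
  nr ((\1_A p)%:C *: v) ^+ 2 = \1_A p * nr v ^+ 2.
Proof.
by rewrite indicE; case: (p \in A); rewrite ?scale1r ?mul1r// scale0r nr0 expr0n mul0r.
Qed.

(** If [x] is [u] cut to [A], then by [Tcut] the integral over [A] of [M^2 |u(p)|^2 - |(T u)(p)|^2]
    is [M^2 |x|^2 - |T x|^2], which is nonnegative for every measurable [A]. *)
Lemma ae_bounded u : W u -> {ae mu, forall p, nr (ev (T u) p) <= M * nr (ev u p)}.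
Proof.
move=> Wu.
pose f x p := M ^+ 2 * nr (ev x p) ^+ 2 - nr (ev (T x) p) ^+ 2.
have fi x : mu.-integrable setT (EFin \o f x).
  exact: (integrableB measurableT (integrableZl measurableT (M ^+ 2)
    (integrable_nr2 ev_inner x)) (integrable_nr2 ev_inner (T x))).
have fI x : \int[mu]_p f x p = M ^+ 2 * nr x ^+ 2 - nr (T x) ^+ 2.
  rewrite RintegralB//; [|exact: (integrableZl measurableT _ (integrable_nr2 ev_inner x))|
    exact: integrable_nr2].
  by rewrite RintegralZl ?Rintegral_nr2//; exact: integrable_nr2.
have : {ae mu, forall p, 0 <= f u p}.
  apply: Rintegral_ge0_ae => // A mA.
  have V0 p : V p 0 by have [] := hV p.
  have [x Wx xu] := cut_exists cmu ev_inner VW V0 mA Wu.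
  rewrite -(Rintegral_ae_eq cmu (f := f x)) ?fI//; last first.
    apply: filterS2 xu (Tcut mA Wu Wx xu) => p; rewrite /f => -> ->.
    by rewrite !nr_indicZ mulrBr mulrCA.
  rewrite subr_ge0 -exprMn; apply: lerXn2r; rewrite ?nnegrE ?mulr_ge0 ?nr_ge0//.
  exact: TM.
apply: filterS => p; rewrite /f subr_ge0 -exprMn ler_pXn2r// nnegrE ?mulr_ge0 ?nr_ge0//.
Qed.

Lemma ae_decomposable : separable_set W -> exists t : forall p, H p -> H p, [/\
  forall p h, V p h -> V p (t p h),
  forall p (a : R[i]) h k, V p h -> V p k -> t p (a *: h + k) = a *: t p h + t p k,
  forall p h, V p h -> nr (t p h) <= M * nr h &
  forall u, W u -> {ae mu, forall p, t p (ev u p) = ev (T u) p}].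
Proof.
move=> sW; have [hW VWx _] := VW; have [W0 WL _] := hW.
have [s [Ws Wapp]] := approximating_sequence W0 sW.
pose good p := [/\ forall n, V p (ev (T (s n)) p),
  V p `<=` approximated (fun n => ev (s n) p) &
  forall (q : rat * rat) l m n,
   nr (ev (T (s l)) p - (ratr q.1 +i* ratr q.2) *: ev (T (s m)) p - ev (T (s n)) p) <=
   M * nr (ev (s l) p - (ratr q.1 +i* ratr q.2) *: ev (s m) p - ev (s n) p)].
have good_ae : {ae mu, forall p, good p}.
  have g1 : {ae mu, forall p, forall n, V p (ev (T (s n)) p)}.
    by apply: ae_foralln => n; apply: VWx; exact: TW.
  have g2 := ae_dense cmu ev_inner evK VW hV Ws Wapp.
  have g3 : {ae mu, forall p, forall l m n k : nat, forall q, unpickle k = Some q ->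
      nr (ev (T (s l)) p - (ratr q.1 +i* ratr q.2) *: ev (T (s m)) p - ev (T (s n)) p) <=
      M * nr (ev (s l) p - (ratr q.1 +i* ratr q.2) *: ev (s m) p - ev (s n) p)}.
    apply: ae_foralln => l; apply: ae_foralln => m; apply: ae_foralln => n.
    apply: ae_foralln => k; case: (unpickle k) => [q|]; last exact: aeW.
    set r : R[i] := ratr q.1 +i* ratr q.2.
    have Wr : W (r *: s m + s n) by exact: WL.
    (* The three-term estimate is [ae_bounded] at this single vector, expanded by linearity of [T]
       and of [ev] almost everywhere. *)
    have Wx : W (s l - (r *: s m + s n)) by exact: hilbert_subspaceB.
    have TE : T (s l - (r *: s m + s n)) = T (s l) - (r *: T (s m) + T (s n)).
      by rewrite -scaleN1r addrC Tlin// Tlin// scaleN1r addrC.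
    apply: filterS3 (ae_bounded Wx)
      (filterI (ev_sub cmu ev_inner evK (s l) (r *: s m + s n))
        (ev_lin cmu ev_inner evK r (s m) (s n)))
      (filterI (ev_sub cmu ev_inner evK (T (s l)) (r *: T (s m) + T (s n)))
        (ev_lin cmu ev_inner evK r (T (s m)) (T (s n)))).
    rewrite TE => p bp [e1 e2] [e3 e4] q' [<-].
    by move: bp; rewrite e1 e2 e3 e4 !opprD !addrA.
  apply: filterS3 g1 g2 g3 => p g1 g2 g3; split=> // q l m n.
  by apply: (g3 l m n (pickle q)); rewrite pickleK.
have ex p : exists t : H p -> H p, [/\
  forall h, V p h -> V p (t h),
  forall (a : R[i]) h k, V p h -> V p k -> t (a *: h + k) = a *: t h + t k,
  forall h, V p h -> nr (t h) <= M * nr h &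
  good p -> forall h, V p h -> forall n,
    nr (t h - ev (T (s n)) p) <= M * nr (h - ev (s n) p)].
  have [gp|ngp] := pselect (good p).
    have [g1 g2 g3] := gp.
    have [t [t1 t2 t3 t4]] := dense_extension M0 (hV p) g1 g2 g3.
    by exists t; split.
  (* The zero map at points that are not [good] keeps the first three properties valid in every
     fibre. *)
  exists (fun=> 0); split=> //.
  - by move=> h _; have [] := hV p.
  - by move=> *; rewrite scaler0 addr0.
  - by move=> h _; rewrite nr0 mulr_ge0// nr_ge0.
exists (fun p => sval (cid (ex p))).
split=> [p|p|p|u Wu].
1-3: by have [] := svalP (cid (ex p)).
(* Both [t p (ev u p)] and [ev (T u) p] lie within [M * nr (ev u p - ev (s n) p)] of
   [ev (T (s n)) p], and this radius can be made arbitrarily small. *)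
have bnd : {ae mu, forall p, forall n,
    nr (ev (T u) p - ev (T (s n)) p) <= M * nr (ev u p - ev (s n) p)}.
  apply: ae_foralln => n.
  have Wx : W (u - s n) by exact: hilbert_subspaceB.
  have TE : T (u - s n) = T u - T (s n).
    by rewrite -scaleN1r addrC Tlin// scaleN1r addrC.
  apply: filterS3 (ae_bounded Wx) (ev_sub cmu ev_inner evK u (s n))
    (ev_sub cmu ev_inner evK (T u) (T (s n))) => p.
  by rewrite TE => + e1 e2; rewrite e1 e2.
apply: filterS3 good_ae bnd (VWx u Wu) => p gp bp Vp.
have [_ _ _ /(_ gp _ Vp)] := svalP (cid (ex p)); move: (sval _) => t tP.
have [_ g2 _] := gp.
apply: nr_eq_lim => e e0.
have d0 : 0 < e / (2 * M + 1) by rewrite divr_gt0// ltr_wpDl// mulr_ge0.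
have [n un] := g2 _ Vp _ d0.
apply: (le_trans (nr_tri (ev (T (s n)) p) _ _)).
rewrite [X in _ + X]nrB; apply: (le_trans (lerD (tP n) (bp n))).
rewrite -mulrDl -mulr2n -mulr_natl.
apply: (@le_trans _ _ (2 * M * (e / (2 * M + 1)))).
  by apply: ler_wpM2l; [rewrite mulr_ge0|exact: ltW].
rewrite mulrCA; apply: ler_piMr; first exact: ltW.
by rewrite ler_pdivrMr ?mul1r ?lerDl// ltr_wpDl// mulr_ge0.
Qed.

End decomposition.

(** * Locally bounded operators *)

Lemma linear_exists (R : nzRingType) (U V : lmodType R) (f : U -> V) :
  (forall a x y, f (a *: x + y) = a *: f x + f y) ->
  exists g : {linear U -> V}, g =1 f.
Proof.
move=> fl.
pose g : {linear U -> V} := HB.pack f (GRing.isLinear.Build R U V *:%R f fl).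
by exists g.
Qed.

Section gluing.
Context (R : realType) dL (L : directedPoset dL) (H : hilbertType R).
Variable F : inductiveSystem L H.

Lemma locHilbertP (u : locHilbert F) : exists a, F a (\val u).
Proof. by have /asboolP[a _ Fu] := valP u; exists a. Qed.

Lemma limit_predP a x : F a x -> x \in limit_pred F.
Proof. by move=> Fx; apply/asboolP; exists a. Qed.

Lemma locHilbert_common (u v : locHilbert F) : exists a, F a (\val u) /\ F a (\val v).
Proof.
have [a Fu] := locHilbertP u; have [b Fv] := locHilbertP v.
have [c [ac bc]] := directed_le a b.
by exists c; split; [exact: (system_le ac)|exact: (system_le bc)].
Qed.

Context (t : L -> H -> H).
Hypothesis tF : forall a h, F a h -> F a (t a h).
Hypothesis tlin : forall a (k : R[i]) x y, F a x -> F a y ->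
  t a (k *: x + y) = k *: t a x + t a y.
Hypothesis tM : forall a, exists M : R, forall h, F a h -> nr (t a h) <= M * nr h.
Hypothesis tcompat : forall a b, (a <= b)%O -> forall h, F a h -> t b h = t a h.
Hypothesis torth : forall a b, (a <= b)%O -> forall h, F b h ->
  orthogonal_set (F a) h -> orthogonal_set (F a) (t b h).

(** Compatibility and directedness make the value at [u] independent of the index chosen among those
    whose space contains [u]. *)
Lemma locBounded_glue : exists T : {linear locHilbert F -> locHilbert F},
  locBounded T /\ forall a u, F a (\val u) -> \val (T u) = t a (\val u).
Proof.
have /choice[f fP] (u : locHilbert F) :
    exists v : locHilbert F, forall a, F a (\val u) -> \val v = t a (\val u).
  have [a Fu] := locHilbertP u.
  exists (LocHilbert (limit_predP (tF Fu))) => b Fbu /=.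
  have [c [ac bc]] := directed_le a b.
  by rewrite -(tcompat ac Fu) (tcompat bc Fbu).
have [k x y|T Tf] := @linear_exists _ _ _ f.
  apply: val_inj; have [a [Fx Fy]] := locHilbert_common x y.
  have Fxy : F a (\val (k *: x + y)).
    by rewrite linearP; have [_ + _] := system_hilbert F a; exact.
  by rewrite linearP /= (fP _ _ Fxy) (fP _ _ Fx) (fP _ _ Fy) linearP; exact: tlin.
exists T; split; last by move=> a u; rewrite Tf; exact: fP.
move=> a; split.
- by move=> u Fu; rewrite Tf (fP _ _ Fu); exact: tF.
(* [u] is orthogonal to [F a], so its value is read at an index [c] above both [a] and an index
   whose space contains [u]. *)
- move=> u uo; have [b Fb] := locHilbertP u; have [c [ac bc]] := directed_le a b.
  have Fc := system_le bc Fb.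
  by rewrite Tf (fP _ _ Fc); apply: (torth ac Fc).
- have [M MP] := tM a; exists M => u Fu.
  by rewrite Tf (fP _ _ Fu) !nrE -rmorphM lecR; exact: MP.
Qed.

End gluing.

Lemma ae_forall_index (dL : Order.disp_t) (L : directedPoset dL) d
    (X : measurableTopologicalType d) (R : realType) (mu : {measure set X -> \bar R}) :
  countable [set: L] \/ is_counting_measure mu ->
  forall P : L -> X -> Prop, (forall a, {ae mu, forall p, P a p}) ->
  {ae mu, forall p, forall a, P a p}.
Proof.
move=> [/countable_injP[f finj]|cmu] P aeP; last first.
  by apply: aeW => p a; apply: (counting_ae cmu (aeP a)).
have : {ae mu, forall p, forall n a, f a = n -> P a p}.
  apply: ae_foralln => n.
  have [[a fa]|na] := pselect (exists a, f a = n).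
    apply: filterS (aeP a) => p Pa b fb.
    by have -> : b = a by apply: finj; rewrite ?inE// fb fa.
  by apply: aeW => p a fa; exfalso; apply: na; exists a.
by apply: filterS => p Pp a; exact: (Pp (f a)).
Qed.

Lemma nr_lipschitz (R : realType) (H : hilbertType R) (V : set H) (t : H -> H) (M : R) :
  hilbert_subspace V ->
  (forall (k : R[i]) x y, V x -> V y -> t (k *: x + y) = k *: t x + t y) ->
  (forall h, V h -> nr (t h) <= M * nr h) ->
  forall h k, V h -> V k -> nr (t h - t k) <= M * nr (h - k).
Proof.
move=> hV tl tM h k Vh Vk.
have -> : t h - t k = t (h - k) by rewrite -scaleN1r addrC -tl// scaleN1r addrC.
by apply: tM; exact: hilbert_subspaceB.
Qed.

(** * Decomposable operators and the commutant of the diagonalizable ones *)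

Section decomposable_commutant.
Context (R : realType) (dL : Order.disp_t) (L : directedPoset dL)
  (d : measure_display) (X : measurableTopologicalType d)
  (mu : {measure set X -> \bar R}).
Hypothesis hmu : borel_completion mu.
Context (Q : X -> quantizedDomain R L) (K : hilbertType R)
  (ev : K -> forall p, qspace (Q p)).
Hypothesis hK : direct_integral mu (fun p => [set: qspace (Q p)]) [set: K] ev.
Context (E : inductiveSystem L K) (evE : L -> K -> forall p, qspace (Q p)).
Hypothesis hE : forall a, direct_integral mu (fun p => qsystem (Q p) a) (E a) (evE a).
Hypothesis hev : forall a x, E a x -> {ae mu, forall p, evE a x p = ev x p}.

Let cmu : measure_is_complete mu := borel_completion_complete hmu.

Let ev_inner x y : cintegrable mu (fun p => inner (ev x p) (ev y p)) /\
  inner x y = cintegral mu (fun p => inner (ev x p) (ev y p)).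
Proof. by have [_ _ + _] := hK; apply. Qed.

Let evK : ae_direct_integral mu ev (fun p => setT) setT.
Proof. by have [[hKT _] _ _ sel] := hK; split=> // x _; exact: aeW. Qed.

(** The almost everywhere agreement of [evE a] with [ev] lets all members of [E] share the single
    map [ev]. *)
Let evEa a : ae_direct_integral mu ev (fun p => qsystem (Q p) a) (E a).
Proof.
have [[hEa _] EV _ sel] := hE a; split=> // [x Ex|w Vw wi].
  by apply: filterS (hev Ex) => p <-; exact: EV.
have [y Ey|x Ex xw] := sel w Vw.
  apply: (cintegrable_ae_eq cmu _ (wi y Ey)).
  by apply: filterS (hev Ey) => p ->.
by exists x => //; apply: filterS2 xw (hev Ex) => p -> ->.
Qed.

Let hQE p a : hilbert_subspace (qsystem (Q p) a) := system_hilbert (qsystem (Q p)) a.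

Lemma val_value_at (u : locHilbert E) :
  {ae mu, forall p, \val (value_at ev u p) = ev (\val u) p}.
Proof.
have [a Eu] := locHilbertP u; have [_ Vu _] := evEa a.
apply: filterS (Vu _ Eu) => p Fp.
by rewrite /value_at insubdK//; exact: limit_predP Fp.
Qed.

Lemma value_at_inj (u v : locHilbert E) :
  {ae mu, forall p, value_at ev u p = value_at ev v p} -> u = v.
Proof.
move=> uv; apply/val_inj/(ev_inj cmu ev_inner evK).
by apply: filterS3 uv (val_value_at u) (val_value_at v) => p + <- <- => ->.
Qed.

Lemma locDecomposable_commutant :
  locDecomposable mu E ev `<=` commutant (locDiagonalizable mu E ev).
Proof.
move=> T [TB [T_ _ TE]]; split=> // U [_ [f _ UE]] u /=.
apply: value_at_inj.
apply: filterS2 (filterI (TE (U u)) (TE u)) (filterI (UE u) (UE (T u))).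
by move=> p [e1 e2] [e3 e4]; rewrite e1 e3 e4 e2 linearZ.
Qed.

(** This supplies the identity and the zero operator of a fibre: the components of an indicator
    multiplication, and the default at exceptional points. *)
Lemma scale_locBounded p (c : bool) :
  exists S : {linear locHilbert (qsystem (Q p)) -> locHilbert (qsystem (Q p))},
    locBounded S /\ forall x, S x = (c%:R : R[i]) *: x.
Proof.
have [k x y|S SE] := @linear_exists _ _ _
  (fun x : locHilbert (qsystem (Q p)) => (c%:R : R[i]) *: x).
  by rewrite scalerDr !scalerA mulrC.
exists S; split=> // a; have [F0 FL _] := hQE p a; split=> [x Fx|x xo y Fy|].
- rewrite SE linearZ /= -[_ *: _]addr0; exact: FL.
- by rewrite SE linearZ /= innerZl xo// mulr0.
- exists 1 => x _; rewrite SE linearZ /= normrZ mul1r.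
  by case: c {S SE}; rewrite ?normr1 ?mul1r// normr0 mul0r normr_ge0.
Qed.

(** Multiplication by an indicator is defined vector by vector through [cut_exists]; linearity and
    independence of the index come from [ev_inj]. *)
Lemma cut_operator A : measurable A ->
  exists2 U, locDiagonalizable mu E ev U &
    forall u, {ae mu, forall p, ev (\val (U u)) p = (\1_A p)%:C *: ev (\val u) p}.
Proof.
move=> mA.
have /choice[f fP] (u : locHilbert E) : exists v : locHilbert E,
    {ae mu, forall p, ev (\val v) p = (\1_A p)%:C *: ev (\val u) p}.
  have [a Eu] := locHilbertP u.
  have V0 p : qsystem (Q p) a 0 by have [] := hQE p a.
  have [x Ex xu] := cut_exists cmu ev_inner (evEa a) V0 mA Eu.
  by exists (LocHilbert (limit_predP Ex)).
have [k x y|U UE] := @linear_exists _ _ _ f.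
  apply/val_inj/(ev_inj cmu ev_inner evK); rewrite !linearP /=.
  apply: filterS3 (filterI (fP (k *: x + y)) (ev_lin cmu ev_inner evK k (\val x) (\val y)))
    (filterI (fP x) (fP y)) (ev_lin cmu ev_inner evK k (\val (f x)) (\val (f y))) => p.
  move=> [e1 e2] [e3 e4] e5.
  by rewrite e1 e5 linearP /= e2 e3 e4 scalerDr !scalerA mulrC.
have UA u : {ae mu, forall p, ev (\val (U u)) p = (\1_A p)%:C *: ev (\val u) p}.
  by rewrite UE; exact: fP.
exists U => //.
have UB : locBounded U.
  move=> a; split=> [u Eu|u uo y Ey|].
  - have V0 p : qsystem (Q p) a 0 by have [] := hQE p a.
    have [x Ex xu] := cut_exists cmu ev_inner (evEa a) V0 mA Eu.
    suff -> : \val (U u) = x by [].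
    by apply: (ev_inj cmu ev_inner evK); apply: filterS2 xu (UA u) => p -> ->.
  (* Orthogonality to [E a] is a fibrewise condition, hence stable under scalar multiplication in
     each fibre. *)
  - move: y Ey; apply/(orthogonal_aeP cmu ev_inner (evEa a) (hQE^~ a)).
    have /(orthogonal_aeP cmu ev_inner (evEa a) (hQE^~ a)) uo' := uo.
    by apply: filterS2 uo' (UA u) => p uo' -> y Fy; rewrite innerZl uo'// mulr0.
  - exists 1 => u _; rewrite mul1r !nrE lecR.
    rewrite -(@ler_pXn2r _ 2)// ?nnegrE ?nr_ge0// -!(Rintegral_nr2 ev_inner).
    have ui := integrable_nr2 ev_inner (\val u).
    rewrite (Rintegral_ae_eq cmu (g := fun p => \1_A p * nr (ev (\val u) p) ^+ 2)).
    + apply: le_Rintegral => // [|p _]; first exact: (integrable_indicM mA ui).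
      by rewrite ler_piMl ?sqr_ge0// indicE lern1 leq_b1.
    + by apply: filterS (UA u) => p ->; exact: (nr_indicZ (H := fun p => qspace (Q p))).
    + exact: integrable_nr2.
have UV u : {ae mu, forall p, value_at ev (U u) p = (\1_A p)%:C *: value_at ev u p}.
  apply: filterS3 (val_value_at (U u)) (val_value_at u) (UA u) => p e1 e2 e3.
  by apply: val_inj; rewrite linearZ /= e1 e2.
split; last first.
  exists (fun p => (\1_A p)%:C) => //; split=> /=; last exact: measurable_cst.
  exact: measurable_indic.
split=> //.
pose S p := sval (cid (scale_locBounded p (p \in A))).
have SP p := svalP (cid (scale_locBounded p (p \in A))).
exists S => [p|u]; first exact: (SP p).1.
apply: filterS (UV u) => p ->; rewrite (SP p).2 indicE.
by rewrite -(rmorph_nat (real_complex R)).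
Qed.

(** * Decomposition of an operator in the commutant *)

Section commuting_operator.
Context (T : {linear locHilbert E -> locHilbert E}).
Hypothesis hT : commutant (locDiagonalizable mu E ev) T.

(* T read on elements of K; its values outside the union of the E a are junk. *)
Let T' (x : K) : K := \val (T (insubd 0 x)).

Let insubdE a x : E a x -> \val (insubd (0 : locHilbert E) x) = x.
Proof. by move=> Ex; rewrite insubdK//; exact: limit_predP Ex. Qed.

Let T'E (u : locHilbert E) : T' (\val u) = \val (T u).
Proof. by rewrite /T' valKd. Qed.

Let T'W a x : E a x -> E a (T' x).
Proof.
move=> Ex; have [TB _] := hT; have [+ _ _] := TB a; apply.
by rewrite (insubdE Ex).
Qed.

Let T'lin a (k : R[i]) x y : E a x -> E a y -> T' (k *: x + y) = k *: T' x + T' y.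
Proof.
move=> Ex Ey; have [_ EL _] := system_hilbert E a.
rewrite /T'; have -> : insubd (0 : locHilbert E) (k *: x + y) = k *: insubd 0 x + insubd 0 y.
  apply: val_inj; rewrite linearP /= (insubdE Ex) (insubdE Ey).
  by rewrite (insubdE (a := a))//; exact: EL.
by rewrite linearP [LHS]linearP.
Qed.

Let T'M a : exists2 M : R, 0 <= M :> R & forall x, E a x -> nr (T' x) <= M * nr x.
Proof.
have [TB _] := hT; have [_ _ [M MP]] := TB a.
exists `|M| => // x Ex; have := MP (insubd 0 x); rewrite (insubdE Ex) => /(_ Ex).
rewrite !nrE -rmorphM lecR => /le_trans; apply.
by apply: ler_wpM2r; [exact: nr_ge0|exact: ler_norm].
Qed.

(** Here [x] is the image of [u] under a cut operator, which is diagonalizable and so commutes with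
    [T]. *)
Let T'cut a A u x : measurable A -> E a u -> E a x ->
  {ae mu, forall p, ev x p = (\1_A p)%:C *: ev u p} ->
  {ae mu, forall p, ev (T' x) p = (\1_A p)%:C *: ev (T' u) p}.
Proof.
move=> mA Eu Ex xu; have [U Ud UA] := cut_operator mA.
have xE : insubd 0 x = U (insubd 0 u).
  apply/val_inj/(ev_inj cmu ev_inner evK); rewrite (insubdE Ex).
  by have := UA (insubd 0 u); rewrite (insubdE Eu); apply: filterS2 xu => p -> ->.
have [_ /(_ _ Ud (insubd 0 u)) /= TU] := hT.
by rewrite /T' xE TU; exact: UA.
Qed.

Let T'orth a (u : locHilbert E) : (forall y, E a y -> inner (\val u) y = 0) ->
  forall y, E a y -> inner (T' (\val u)) y = 0.
Proof. by move=> uo y Ey; rewrite T'E; have [TB _] := hT; have [_ + _] := TB a; apply. Qed.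

Let fibre_operators : exists (t : L -> forall p, qspace (Q p) -> qspace (Q p)) (M : L -> R),
  (forall a, 0 <= M a :> R) /\ forall a, [/\
  forall p h, qsystem (Q p) a h -> qsystem (Q p) a (t a p h),
  forall p (k : R[i]) x y, qsystem (Q p) a x -> qsystem (Q p) a y ->
    t a p (k *: x + y) = k *: t a p x + t a p y,
  forall p h, qsystem (Q p) a h -> nr (t a p h) <= M a * nr h &
  forall u, E a u -> {ae mu, forall p, t a p (ev u p) = ev (T' u) p}].
Proof.
have /choice[M MP] a : exists M : R, 0 <= M :> R /\ forall x, E a x -> nr (T' x) <= M * nr x.
  by have [M M0 MP] := T'M a; exists M.
have /choice[t tP] a := ae_decomposable cmu ev_inner evK (evEa a) (hQE^~ a) (MP a).1
  (@T'W a) (@T'lin a) (MP a).2 (@T'cut a) (let: And4 (conj _ sE) _ _ _ := hE a in sE).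
by exists t, M; split=> [a|a]; [exact: (MP a).1|exact: tP].
Qed.

Lemma commutant_locDecomposable :
  countable [set: L] \/ is_counting_measure mu -> locDecomposable mu E ev T.
Proof.
move=> hL; split; first by have [] := hT.
have [t [M [M0 tP]]] := fibre_operators.
have tE a u : E a u -> {ae mu, forall p, t a p (ev u p) = ev (T' u) p}.
  by have [_ _ _] := tP a; apply.
have tLip a p h k : qsystem (Q p) a h -> qsystem (Q p) a k ->
    nr (t a p h - t a p k) <= M a * nr (h - k).
  by have [_ tl tM _] := tP a; apply: (nr_lipschitz (hQE p a)); [exact: tl|exact: tM].
have evV a x : E a x -> {ae mu, forall p, qsystem (Q p) a (ev x p)}.
  by have [_ + _] := evEa a; apply.
have sexists a : exists s : nat -> K, (forall n, E a (s n)) /\ E a `<=` approximated s.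
  have [E0 _ _] := system_hilbert E a; have [[_ sE] _ _ _] := hE a.
  exact: approximating_sequence.
pose compat p := forall a b, (a <= b)%O -> forall h, qsystem (Q p) a h -> t b p h = t a p h.
pose orth p := forall a b, (a <= b)%O -> forall h, qsystem (Q p) b h ->
  orthogonal_set (qsystem (Q p) a) h -> orthogonal_set (qsystem (Q p) a) (t b p h).
have compat_ae : {ae mu, forall p, compat p}.
  apply: ae_forall_index => // a; apply: ae_forall_index => // b.
  have [ab|nab] := pselect (a <= b)%O; last exact: aeW.
  have [s [Es sa]] := sexists a.
  have eqs : {ae mu, forall p, forall n, t b p (ev (s n) p) = t a p (ev (s n) p)}.
    (* On the values of a dense sequence of [E a] both fibre operators give the value of [T' (s n)];
       Lipschitz continuity extends the equality to the whole fibre. *)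
    apply: ae_foralln => n.
    by apply: filterS2 (tE _ _ (Es n)) (tE b _ (system_le ab (Es n))) => p -> ->.
  have Vs : {ae mu, forall p, forall n, qsystem (Q p) a (ev (s n) p)}.
    by apply: ae_foralln => n; exact: evV.
  apply: filterS3 eqs Vs (ae_dense cmu ev_inner evK (evEa a) (hQE^~ a) Es sa).
  move=> p eqs Vs sd _ h Fh; apply: nr_eq_lim => e e0.
  have d0 : 0 < e / (M a + M b + 1) by rewrite divr_gt0// ltr_wpDl// addr_ge0.
  have [n hn] := sd h Fh _ d0.
  apply: (le_trans (nr_tri (t b p (ev (s n) p)) _ _)); rewrite {2}eqs.
  have Fbh := system_le ab Fh; have Fbs := system_le ab (Vs n).
  rewrite [X in _ + X]nrB.
  apply: (le_trans (lerD (tLip b p _ _ Fbh Fbs) (tLip a p _ _ Fh (Vs n)))).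
  rewrite -mulrDl [M b + _]addrC.
  apply: (le_trans (ler_wpM2l (addr_ge0 (M0 a) (M0 b)) (ltW hn))).
  rewrite mulrCA; apply: ler_piMr; first exact: ltW.
  by rewrite ler_pdivrMr ?mul1r ?lerDl// ltr_wpDl// addr_ge0.
have orth_ae : {ae mu, forall p, orth p}.
  apply: ae_forall_index => // a; apply: ae_forall_index => // b.
  have [ab|nab] := pselect (a <= b)%O; last exact: aeW.
  have [s [Es sb]] := sexists b.
  have proj : {ae mu, forall p, forall n, exists z,
      [/\ qsystem (Q p) a z, qsystem (Q p) b (ev (s n) p),
       orthogonal_set (qsystem (Q p) a) (ev (s n) p - z) &
       orthogonal_set (qsystem (Q p) a) (t b p (ev (s n) p - z))]}.
    apply: ae_foralln => n.
    (* Removing the projection onto [E a] gives vectors of [E b] orthogonal to [E a], a relation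
       that [T] preserves; it then passes to almost every fibre. *)
    have [z Ez zP] := projection_section cmu ev_inner (s n) (evEa a) (hQE^~ a).
    have Esz : E b (s n - z).
      by apply: (hilbert_subspaceB (system_hilbert E b)) => //; exact: system_le ab _ Ez.
    have szo : forall y, E a y -> inner (s n - z) y = 0.
      apply/(orthogonal_aeP cmu ev_inner (evEa a) (hQE^~ a)).
      by apply: filterS2 zP (ev_sub cmu ev_inner evK (s n) z) => p + ->.
    have Tszo : forall y, E a y -> inner (T' (s n - z)) y = 0.
      rewrite -(insubdE Esz) in szo *; exact: T'orth.
    have /(orthogonal_aeP cmu ev_inner (evEa a) (hQE^~ a)) Tszo' := Tszo.
    apply: filterS3 (filterI zP Tszo') (filterI (evV _ _ Ez) (evV _ _ (Es n)))
      (filterI (tE _ _ Esz) (ev_sub cmu ev_inner evK (s n) z)).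
    move=> p [zp Tp] [Fz Fs] [tp ep]; exists (ev z p); split=> //.
    by rewrite -ep tp.
  apply: filterS2 proj (ae_dense cmu ev_inner evK (evEa b) (hQE^~ b) Es sb).
  move=> p proj sd _ h Fh ho y Fy.
  rewrite innerC; suff -> : inner y (t b p h) = 0 by rewrite rmorph0.
  apply: inner_eq0_lim => e e0.
  have d0 : 0 < e / (M b + 1) by rewrite divr_gt0// ltr_wpDl.
  have [n hn] := sd h Fh _ d0; have [z [Fz Fs szo tszo]] := proj n.
  exists (t b p (ev (s n) p - z)); first by rewrite innerC tszo// rmorph0.
  have Fsz : qsystem (Q p) b (ev (s n) p - z).
    by apply: hilbert_subspaceB => //; exact: system_le ab _ Fz.
  apply: (le_lt_trans (tLip b p _ _ Fh Fsz)).
  (* Pythagoras: [h] and [ev (s n) p - z] are orthogonal to the fibre of index [a], which contains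
     [z], so the residuals approximate [h] at least as well as the sequence itself. *)
  have hsz : nr (h - (ev (s n) p - z)) <= nr (h - ev (s n) p).
    rewrite -(@ler_pXn2r _ 2)// ?nnegrE ?nr_ge0//.
    have -> : h - ev (s n) p = h - (ev (s n) p - z) - z by rewrite -[RHS]addrA -opprD subrK.
    rewrite [leRHS]nr_sqB innerBl ho// szo// subrr /= mulr0 subr0.
    by rewrite lerDl sqr_ge0.
  apply: (le_lt_trans (ler_wpM2l (M0 b) hsz)).
  apply: (le_lt_trans (ler_wpM2l (M0 b) (ltW hn))).
  rewrite mulrCA -[ltRHS]mulr1 ltr_pM2l// ltr_pdivrMr ?ltr_wpDl//.
  by rewrite mul1r ltrDl.
have ex p : exists S : {linear locHilbert (qsystem (Q p)) -> locHilbert (qsystem (Q p))},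
    locBounded S /\ (compat p /\ orth p -> forall a u,
      qsystem (Q p) a (\val u) -> \val (S u) = t a p (\val u)).
  have [[cp op]|np] := pselect (compat p /\ orth p).
    have [||a|||S [SB SE]] := @locBounded_glue _ _ _ _ (qsystem (Q p)) (fun a => t a p).
    - by move=> a; have [+ _ _ _] := tP a; apply.
    - by move=> a; have [_ + _ _] := tP a; apply.
    - by exists (M a); have [_ _ + _] := tP a; apply.
    - exact: cp.
    - exact: op.
    by exists S; split.
  (* At points where compatibility or preservation of orthogonality fails, the zero operator is
     used. *)
  have [S [SB _]] := scale_locBounded p false.
  by exists S; split.
pose S p := sval (cid (ex p)); have SP p := svalP (cid (ex p)).
exists S => [p|u]; first exact: (SP p).1.
have [a Eu] := locHilbertP u.
apply: filterS3 (filterI compat_ae orth_ae) (filterI (val_value_at u) (val_value_at (T u)))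
  (filterI (tE _ _ Eu) (evV _ _ Eu)) => p good [e1 e2] [e3 Fp].
apply: val_inj; rewrite e2 -T'E -e3 -e1.
by rewrite ((SP p).2 good a)// e1.
Qed.

End commuting_operator.
End decomposable_commutant.

Theorem theorem3p6 (R : realType) (dL : Order.disp_t) (L : directedPoset dL)
    (d : measure_display) (X : measurableTopologicalType d)
    (mu : {measure set X -> \bar R})
    (hXs : sigma_compact X) (hXl : locally_compact [set: X])
    (hmu : borel_completion mu)
    (Q : X -> quantizedDomain R L)
    (hQ : forall p, separable_set [set: qspace (Q p)])
    (K : hilbertType R) (ev : K -> forall p, qspace (Q p))
    (hK : direct_integral mu (fun p => [set: qspace (Q p)]) [set: K] ev)
    (E : inductiveSystem L K) (evE : L -> K -> forall p, qspace (Q p))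
    (hE : forall a, direct_integral mu (fun p => qsystem (Q p) a) (E a) (evE a))
    (hev : forall a x, E a x -> {ae mu, forall p, evE a x p = ev x p})
    (hL : countable [set: L] \/ is_counting_measure mu) :
  locDecomposable mu E ev = commutant (locDiagonalizable mu E ev).
Proof.
apply/seteqP; split=> T.
  exact: (locDecomposable_commutant hmu hK hE hev).
move=> hT; exact: (commutant_locDecomposable hmu hK hE hev hT hL).
Qed.
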